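(* Let $0<\alpha<1$ and $p,q>0$. Then the following conditions are equivalent: (i) $G_{\alpha,p}(A,B)\le\mathcal{A}_{\alpha,q}(A,B)$ for all positive semidefinite $A,B\in\mathbb{M}_n$ and all $n\in\mathbb{N}$; (ii) $G_{\alpha,p}(A,B)\le\mathcal{A}_{\alpha,q}(A,B)$ for all positive definite $2\times2$ matrices $A,B$; (iii) $1\le p\le q$.
   Context: $\mathbb{M}_n$ is the set of $n\times n$ complex matrices, and $\le$ is the Loewner order. For positive definite $A,B$, $A\#_\alpha B:=A^{1/2}(A^{-1/2}BA^{-1/2})^\alpha A^{1/2}$; for positive semidefinite $A,B$, $A\#_\alpha B:=\lim_{\varepsilon\searrow0}(A+\varepsilon I)\#_\alpha(B+\varepsilon I)$. Then $G_{\alpha,p}(A,B):=(A^p\#_\alpha B^p)^{1/p}$ and $\mathcal{A}_{\alpha,q}(A,B):=((1-\alpha)A^q+\alpha B^q)^{1/q}$. *)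

(* Defs.v *)
From HB Require Import structures.
From mathcomp Require Import all_boot all_order all_algebra.
From mathcomp Require Import sesquilinear spectral.
From mathcomp Require Import boolp classical_sets reals exp topology normedtype.
From mathcomp Require Import complex.
Set Implicit Arguments. Unset Strict Implicit. Unset Printing Implicit Defensive.
Import Order.TTheory GRing.Theory Num.Theory.
Import numFieldNormedType.Exports.
Local Open Scope ring_scope.
Local Open Scope classical_set_scope.
Local Open Scope sesquilinear_scope.

Section Defs.
Variable R : realType.
Local Notation C := (R[i]).

Definition psdmx n (A : 'M[C]_n) : Prop :=
  forall x : 'cV[C]_n, 0 <= (x ^t* *m A *m x) 0 0.
Definition pdmx n (A : 'M[C]_n) : Prop :=
  forall x : 'cV[C]_n, x != 0 -> 0 < (x ^t* *m A *m x) 0 0.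

Definition loewner_le n (A B : 'M[C]_n) : Prop := psdmx (B - A).

(* real power A^t of a positive semidefinite matrix via functional calculus
   on the spectral decomposition A = U^-1 diag(d) U (U unitary, d real);
   powR 0 t = 0 for t <> 0. *)
Definition mxpowR n (A : 'M[C]_n) (t : R) : 'M[C]_n :=
  invmx (spectralmx A) *m
  diag_mx (\row_i ((powR (complex.Re (spectral_diag A 0 i)) t)%:C)%C) *m
  spectralmx A.

Definition wgm_pd n (A B : 'M[C]_n) (a : R) : 'M[C]_n :=
  mxpowR A (2^-1) *m
  mxpowR (mxpowR A (- 2^-1) *m B *m mxpowR A (- 2^-1)) a *m mxpowR A (2^-1).

Definition mx_cvg_right0 n (F : R -> 'M[C]_n) (L : 'M[C]_n) : Prop :=
  forall i j,
    ((fun e => complex.Re (F e i j)) @ 0^'+ --> complex.Re (L i j)) /\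
    ((fun e => complex.Im (F e i j)) @ 0^'+ --> complex.Im (L i j)).

Definition wgm n (A B : 'M[C]_n) (a : R) : 'M[C]_n :=
  if `[< pdmx A /\ pdmx B >] then wgm_pd A B a
  else xget 0 [set L | mx_cvg_right0
         (fun e => wgm_pd (A + (e%:C)%C%:M) (B + (e%:C)%C%:M) a) L].

Definition Gmean n (a p : R) (A B : 'M[C]_n) : 'M[C]_n :=
  mxpowR (wgm (mxpowR A p) (mxpowR B p) a) (p^-1).

Definition Amean n (a q : R) (A B : 'M[C]_n) : 'M[C]_n :=
  mxpowR (((1 - a)%:C)%C *: mxpowR A q + (a%:C)%C *: mxpowR B q) (q^-1).

End Defs.

(* Main.v *)
(** (iii) => (i): by the scalar inequality [x^a <= (1-a) + a x], the mean
    [A^p #_a B^p] is below [(1-a) A^p + a B^p]; since [A^p = (A^q)^(p/q)], operator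
    concavity of [x^(p/q)] and operator monotonicity of [x^(1/p)] give the claim.
    Both properties come at once from a midpoint argument: if exponents [r] and [s]
    are good then so is [(r+s)/2], because [X^((r+s)/2)] is the geometric mean of
    the commuting matrices [X^r] and [X^s]; dyadic exponents are dense.

    (ii) => (iii): test on [A = diag(1, x)] and [B] with spectrum [{1, d}], the axis
    of [B] being rotated by an angle of squared sine [T].  With [x -> 0] and
    [T = d^(p+q)], [d -> 0], the inequality becomes [O(d^q) >= c d^(p+q-1)], so
    [p >= 1].  With [x -> +oo] it yields
    [(1 + T(d^p - 1))^a <= (1 + a T(d^q - 1))^(p/q)], and [T = d^-p], [d -> +oo]
    excludes [p > q]. *)
Require Import Defs.
From HB Require Import structures.
From mathcomp Require Import all_boot all_order all_algebra.
From mathcomp Require Import sesquilinear spectral.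
From mathcomp Require Import boolp classical_sets reals exp topology normedtype.
From mathcomp Require Import complex.
From mathcomp Require Import functions sequences.
From mathcomp Require Import ring lra.
Set Implicit Arguments. Unset Strict Implicit. Unset Printing Implicit Defensive.
Import Order.TTheory GRing.Theory Num.Theory.
Import numFieldNormedType.Exports.
Local Open Scope ring_scope.
Local Open Scope sesquilinear_scope.

(** In (ii) => (iii) no eigenvalue is computed. Each matrix inequality is reduced to a diagonal
    entry at the first axis [e1], and entries of powers are estimated by Jensen's inequality or by a
    scalar minorant on the spectrum.

    For [x -> 0] the geometric side is nearly the rank one matrix [L e1 e1^t] with
    [L = (1 - T + T d^-p)^(-a/p)]. Such a matrix lies below a positive definite [Y] exactly when
    [L (Y^-1)_11 <= 1]. For [Y = M^(1/q)], with [M] the average of the [q]-th powers, the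
    off-diagonal entry pushes [(Y^-1)_11] above 1 by at least a multiple of [M_12^2 / M_22^(1/q)],
    which is of order [T / d], while [L] falls below 1 only by the order of [T d^-p]. The choice
    [T = d^(p+q)] makes this loss [d^q], the same order as [M_22].

    For [x -> +oo] the inequality is inverted first, because then [A^-1] tends to the projection on
    [e1]. The choice [T = d^-p] keeps [T d^p = 1], while [T d^q] tends to 0 if [p > q]. *)

Section GenericHermitian.
Variable K : numClosedFieldType.

(** Nonnegative values are real, so the form of [A^t* - A] vanishes identically, and polarization
    forces a matrix with vanishing form to be 0. Self-adjointness is thus a consequence of [psdmx],
    whose definition does not ask for it. *)
Lemma ge0_form_adj n (A : 'M[K]_n) :
  (forall x : 'cV[K]_n, 0 <= (x^t* *m A *m x) 0 0) -> A^t* = A.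
Proof.
move=> pA.
have hq (v : 'cV[K]_n) : (v^t* *m (A^t* - A) *m v) 0 0 = 0.
  have := pA v; rewrite mulmxBr mulmxBl => h.
  have -> : v^t* *m A^t* *m v = (v^t* *m A *m v)^t*.
    by rewrite !(trmx_mul, map_mxM) trmxCK mulmxA.
  have Es (X : 'M[K]_1) : (X^t* - X) 0 0 = (X 0 0)^* - X 0 0 by rewrite !mxE.
  by rewrite Es; apply/eqP; rewrite subr_eq0; apply/eqP/CrealP/ger0_real.
have [H HE] : exists H, H = A^t* - A by exists (A^t* - A).
rewrite -HE in hq.
have e i j : ((delta_mx i 0 : 'cV[K]_n)^t* *m H *m (delta_mx j 0 : 'cV[K]_n)) 0 0 = H i j.
  rewrite mxE (bigD1 j) //= [X in _ + X]big1 ?addr0 => [|o no]; last first.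
    by rewrite [X in _ * X]mxE (negPf no) mulr0.
  rewrite [X in _ * X]mxE !eqxx mulr1 mxE (bigD1 i) //= !mxE !eqxx conjC1 mul1r big1 ?addr0 // => o no.
  by rewrite !mxE (negPf no) conjC0 mul0r.
(* The form at [e_i + k e_j]: [k = 1] gives [H j i = - H i j], and [k = 'i] gives
   [H j i = H i j]. *)
have hD i j (k : K) : k^* * H j i + k * H i j = 0.
  have := hq (delta_mx i 0 + k *: delta_mx j 0).
  have -> : (delta_mx i 0 + k *: delta_mx j 0 : 'cV[K]_n)^t* =
      (delta_mx i 0 : 'cV[K]_n)^t* + k^* *: (delta_mx j 0 : 'cV[K]_n)^t*.
    by apply/matrixP => l m; rewrite !mxE rmorphD rmorphM.
  rewrite !mulmxDl !mulmxDr -!scalemxAl -!scalemxAr.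
  have e2 l : H l l = 0 by rewrite -e hq.
  have EE (a b c d : 'M[K]_1) : (a + b + (c + d)) 0 0 = a 0 0 + b 0 0 + (c 0 0 + d 0 0) by rewrite !mxE.
  have EZ (x : K) (a : 'M[K]_1) : (x *: a) 0 0 = x * a 0 0 by rewrite !mxE.
  by rewrite EE !EZ !e !e2 !mulr0 addr0 add0r addrC.
suff : H = 0 by rewrite HE => /eqP; rewrite subr_eq0 => /eqP.
apply/matrixP => i j; rewrite [RHS]mxE.
have := hD i j 'i; have := hD i j 1.
rewrite conjC1 !mul1r conjCi => h1.
rewrite mulNr addrC -mulrBr => /eqP; rewrite mulf_eq0 (negPf (neq0Ci _)) /=.
rewrite subr_eq0 => /eqP h2; move: h1; rewrite -h2 -mulr2n => /eqP.
by rewrite mulrn_eq0 /= => /eqP.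
Qed.

End GenericHermitian.

(** * Real-valued forms of complex matrices *)

Section Forms.
Variable R : realType.
Local Notation C := (R[i]).
Local Notation toC := (real_complex R).

(** The real part makes the form bilinear over [R], so that estimates take place in an ordered
    field. For a Hermitian matrix [qform] loses nothing, by [qform_real]. *)
Definition bform n (A : 'M[C]_n) (u v : 'cV[C]_n) : R := complex.Re ((u^t* *m A *m v) 0 0).
Definition qform n (A : 'M[C]_n) (v : 'cV[C]_n) : R := bform A v v.
Definition hermmx n (A : 'M[C]_n) : Prop := A^t* = A.
Definition nrm2 (z : C) : R := complex.Re z ^+ 2 + complex.Im z ^+ 2.

Lemma conjCE (z : C) : z^* = conjc z. Proof. by []. Qed.

Lemma ReD (x y : C) : complex.Re (x + y) = complex.Re x + complex.Re y.
Proof. by case: x; case: y. Qed.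
Lemma ReN (x : C) : complex.Re (- x) = - complex.Re x.
Proof. by case: x. Qed.
Lemma ReZ (k : R) (x : C) : complex.Re (k%:C%C * x) = k * complex.Re x.
Proof. by case: x => x y /=; rewrite mul0r subr0. Qed.
Lemma Re_conj (x : C) : complex.Re (x^*) = complex.Re x.
Proof. by case: x. Qed.
Lemma Re_sum I (r : seq I) (P : pred I) (F : I -> C) :
  complex.Re (\sum_(i <- r | P i) F i) = \sum_(i <- r | P i) complex.Re (F i).
Proof. by apply: (big_morph (@complex.Re R)) => // x y; rewrite ReD. Qed.

Lemma nrm2_ge0 z : 0 <= nrm2 z.
Proof. by rewrite /nrm2 addr_ge0 ?sqr_ge0. Qed.
Lemma mulJ_nrm2 z : z^* * z = (nrm2 z)%:C%C.
Proof. by case: z => x y; rewrite conjCE /nrm2 /=; simpc; congr Complex; ring. Qed.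
Lemma nrm2_gt0 z : (0 < nrm2 z) = (z != 0).
Proof.
rewrite lt_def nrm2_ge0 andbT /nrm2 paddr_eq0 ?sqr_ge0 // !sqrf_eq0.
by case: z => x y; rewrite eq_complex.
Qed.

Lemma adjM m n p (A : 'M[C]_(m,n)) (B : 'M[C]_(n,p)) : (A *m B)^t* = B^t* *m A^t*.
Proof. by rewrite trmx_mul map_mxM. Qed.
Lemma adjD m n (A B : 'M[C]_(m,n)) : (A + B)^t* = A^t* + B^t*.
Proof. by apply/matrixP => i j; rewrite !mxE raddfD. Qed.
Lemma adjZ m n (k : R) (A : 'M[C]_(m,n)) : (k%:C%C *: A)^t* = k%:C%C *: A^t*.
Proof. by apply/matrixP => i j; rewrite !mxE rmorphM /= conjCE conjc_real. Qed.
Lemma adj_scalar n (k : R) : ((k%:C%C)%:M : 'M[C]_n)^t* = (k%:C%C)%:M.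
Proof. by rewrite tr_scalar_mx map_scalar_mx /= conjCE conjc_real. Qed.

Lemma bformDl n (A B : 'M[C]_n) u v : bform (A + B) u v = bform A u v + bform B u v.
Proof. by rewrite /bform mulmxDr mulmxDl mxE ReD. Qed.
Lemma bformZl n (k : R) (A : 'M[C]_n) u v : bform (k%:C%C *: A) u v = k * bform A u v.
Proof. by rewrite /bform -scalemxAr -scalemxAl mxE ReZ. Qed.
Lemma bformNl n (A : 'M[C]_n) u v : bform (- A) u v = - bform A u v.
Proof. by rewrite /bform mulmxN mulNmx mxE ReN. Qed.
Lemma bform_congr n (S T A : 'M[C]_n) u v : bform (S^t* *m A *m T) u v = bform A (S *m u) (T *m v).
Proof. by rewrite /bform adjM !mulmxA. Qed.
Lemma bformMr n (A T : 'M[C]_n) u v : bform (A *m T) u v = bform A u (T *m v).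
Proof. by rewrite /bform !mulmxA. Qed.
Lemma bform_herm n (A : 'M[C]_n) u v : hermmx A -> bform A u v = bform A v u.
Proof.
move=> hA; rewrite /bform -Re_conj; congr (complex.Re _).
have -> : ((u^t* *m A *m v) 0 0)^* = ((u^t* *m A *m v)^t*) 0 0 by rewrite !mxE.
by rewrite !adjM trmxCK hA mulmxA.
Qed.
Lemma bformDv n (A : 'M[C]_n) u v w : bform A u (v + w) = bform A u v + bform A u w.
Proof. by rewrite /bform mulmxDr mxE ReD. Qed.
Lemma bformZv n (k : R) (A : 'M[C]_n) u v : bform A u (k%:C%C *: v) = k * bform A u v.
Proof. by rewrite /bform -scalemxAr mxE ReZ. Qed.
Lemma bformDu n (A : 'M[C]_n) u v w : bform A (u + v) w = bform A u w + bform A v w.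
Proof. by rewrite /bform adjD !mulmxDl mxE ReD. Qed.
Lemma bformZu n (k : R) (A : 'M[C]_n) u v : bform A (k%:C%C *: u) v = k * bform A u v.
Proof. by rewrite /bform adjZ -!scalemxAl mxE ReZ. Qed.

Lemma qform1 n (v : 'cV[C]_n) : qform 1%:M v = \sum_i nrm2 (v i 0).
Proof.
rewrite /qform /bform mulmx1 mxE Re_sum; apply: eq_bigr => i _.
by rewrite !mxE mulJ_nrm2.
Qed.

Lemma qform_real n (A : 'M[C]_n) v : hermmx A ->
  (v^t* *m A *m v) 0 0 = (qform A v)%:C%C.
Proof.
move=> hA; apply: esym; apply/RRe_real/CrealP.
have -> : ((v^t* *m A *m v) 0 0)^* = ((v^t* *m A *m v)^t*) 0 0 by rewrite !mxE.
by rewrite !adjM trmxCK hA mulmxA.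
Qed.

Lemma psd_herm n (A : 'M[C]_n) : psdmx A -> hermmx A.
Proof. exact: ge0_form_adj. Qed.

Lemma psdP n (A : 'M[C]_n) : psdmx A <-> hermmx A /\ forall v, 0 <= qform A v.
Proof.
split=> [pA|[hA pA] v]; last by rewrite qform_real // lecR.
have hA := psd_herm pA; split=> // v; move: (pA v); by rewrite qform_real // lecR.
Qed.

Lemma pd_psd n (A : 'M[C]_n) : pdmx A -> psdmx A.
Proof.
move=> pA v; have [->|/pA/ltW//] := eqVneq v 0; by rewrite mulmx0 mxE.
Qed.

Lemma pdP n (A : 'M[C]_n) : pdmx A <-> hermmx A /\ forall v, v != 0 -> 0 < qform A v.
Proof.
split=> [pA|[hA pA] v v0]; last by rewrite qform_real // ltcR pA.
have hA := psd_herm (pd_psd pA); split=> // v v0; move: (pA v v0); by rewrite qform_real // ltcR.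
Qed.

Lemma hermD n (A B : 'M[C]_n) : hermmx A -> hermmx B -> hermmx (A + B).
Proof. by rewrite /hermmx adjD => -> ->. Qed.
Lemma hermZ n (k : R) (A : 'M[C]_n) : hermmx A -> hermmx (k%:C%C *: A).
Proof. by rewrite /hermmx adjZ => ->. Qed.
Lemma herm_scalar n (k : R) : hermmx ((k%:C%C)%:M : 'M[C]_n).
Proof. exact: adj_scalar. Qed.
Lemma hermN n (A : 'M[C]_n) : hermmx A -> hermmx (- A).
Proof. by rewrite /hermmx => {2}<-; apply/matrixP => i j; rewrite !mxE raddfN. Qed.
Lemma herm_congr n (S A : 'M[C]_n) : hermmx A -> hermmx (S^t* *m A *m S).
Proof. by move=> hA; rewrite /hermmx !adjM trmxCK hA mulmxA. Qed.

Lemma loewnerP n (A B : 'M[C]_n) : hermmx A -> hermmx B ->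
  loewner_le A B <-> forall v, qform A v <= qform B v.
Proof.
move=> hA hB; rewrite /loewner_le psdP; split=> [[_ h] v|h].
  by move: (h v); rewrite /qform bformDl bformNl subr_ge0.
split; first exact/hermD/hermN.
by move=> v; rewrite /qform bformDl bformNl subr_ge0; apply: h.
Qed.

Lemma qformD n (A B : 'M[C]_n) v : qform (A + B) v = qform A v + qform B v.
Proof. exact: bformDl. Qed.
Lemma qformZ n (k : R) (A : 'M[C]_n) v : qform (k%:C%C *: A) v = k * qform A v.
Proof. exact: bformZl. Qed.
Lemma qform_scalar n (k : R) (v : 'cV[C]_n) : qform (k%:C%C)%:M v = k * qform 1%:M v.
Proof. by rewrite /qform /bform mul_mx_scalar -scalemxAl mxE ReZ mulmx1. Qed.
Lemma qform_congr n (S A : 'M[C]_n) v : qform (S^t* *m A *m S) v = qform A (S *m v).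
Proof. exact: bform_congr. Qed.
Lemma qform1_gt0 n (v : 'cV[C]_n) : v != 0 -> 0 < qform 1%:M v.
Proof.
move=> v0; rewrite qform1 lt_def sumr_ge0 ?andbT => [|i _]; last exact: nrm2_ge0.
apply: contraNneq v0 => h; apply/eqP/matrixP => i j; rewrite ord1 [RHS]mxE.
have /psumr_eq0P/(_ i isT) := h => /(_ (fun i _ => nrm2_ge0 _)) /eqP.
by apply: contraTeq => h0; rewrite gt_eqF // nrm2_gt0.
Qed.

End Forms.

(** The functional calculus does not depend on the diagonalization: [W = V U^t*] intertwines the two
    diagonal matrices, so [W i j != 0] forces [d j = e i], hence [f (d j) = f (e i)], and [W]
    intertwines the images as well. *)
Lemma unitary_diag_map (K : numClosedFieldType) n (U V : 'M[K]_n) (d e : 'rV[K]_n) (f : K -> K) :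
  U \is unitarymx -> V \is unitarymx ->
  U^t* *m diag_mx d *m U = V^t* *m diag_mx e *m V ->
  U^t* *m diag_mx (\row_i f (d 0 i)) *m U = V^t* *m diag_mx (\row_i f (e 0 i)) *m V.
Proof.
move=> hU hV /(congr1 (fun X => V *m X *m U^t*)).
have hVV : V *m V^t* = 1%:M by apply/unitarymxP.
have hUU : U *m U^t* = 1%:M by apply/unitarymxP.
rewrite !mulmxA hVV mul1mx -[LHS]mulmxA hUU mulmx1 -[RHS]mulmxA => h.
have {}h : (V *m U^t*) *m diag_mx (\row_i f (d 0 i)) = diag_mx (\row_i f (e 0 i)) *m (V *m U^t*).
  apply/matrixP => i j; move/matrixP/(_ i j) : h.
  rewrite !mul_mx_diag !mul_diag_mx !mxE.
  set w := \sum_k _.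
  have [->|w0 h] := eqVneq w 0; first by rewrite !(mul0r, mulr0).
  rewrite mulrC; congr (_ * _); congr f.
  by apply: (mulIf w0); rewrite -h mulrC.
have /(congr1 (fun X => V^t* *m X *m U)) := h.
have hV2 : V^t* *m V = 1%:M by rewrite -invmx_unitary // mulVmx // unitarymx_unit.
have hU2 : U^t* *m U = 1%:M by rewrite -invmx_unitary // mulVmx // unitarymx_unit.
by rewrite !mulmxA hV2 mul1mx => ->; rewrite -[LHS]mulmxA hU2 mulmx1.
Qed.

(** * Functional calculus *)

Section Calculus.
Variable R : realType.
Local Notation C := (R[i]).

Definition eigv n (A : 'M[C]_n) (i : 'I_n) : R := complex.Re (spectral_diag A 0 i).
(** The mass that the spectral measure of [A] at [v] gives to the [i]-th eigenvector;
    [qform (fcm f A) v] is the integral of [f] against it ([qform_fcm]). *)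
Definition wt n (A : 'M[C]_n) (v : 'cV[C]_n) (i : 'I_n) : R := nrm2 ((spectralmx A *m v) i 0).
Definition cdiag n (U : 'M[C]_n) (d : 'I_n -> R) : 'M[C]_n :=
  U^t* *m diag_mx (\row_i ((d i)%:C)%C) *m U.
Definition fcm n (f : R -> R) (A : 'M[C]_n) : 'M[C]_n :=
  cdiag (spectralmx A) (fun i => f (eigv A i)).

Lemma mxpowRE n (A : 'M[C]_n) t : mxpowR A t = fcm (fun x => powR x t) A.
Proof. by rewrite /mxpowR /fcm /cdiag invmx_unitary // spectral_unitarymx. Qed.

Lemma spectral_herm n (A : 'M[C]_n) : hermmx A -> A = cdiag (spectralmx A) (eigv A).
Proof.
move=> hA.
have hh : A \is hermsymmx by apply/is_hermitianmxP; rewrite expr0 scale1r hA.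
have /orthomx_spectralP := hermitian_normalmx hh.
rewrite invmx_unitary ?spectral_unitarymx // => h.
have hd : spectral_diag A = \row_i ((eigv A i)%:C)%C.
  apply/matrixP => i j; rewrite [RHS]mxE /eigv ord1 RRe_real //.
  by have /mxOverP := hermitian_spectral_diag_real hh.
by rewrite /cdiag -hd.
Qed.

Lemma cdiag_map n (U V : 'M[C]_n) (d e : 'I_n -> R) (f : R -> R) :
  U \is unitarymx -> V \is unitarymx -> cdiag U d = cdiag V e ->
  cdiag U (fun i => f (d i)) = cdiag V (fun i => f (e i)).
Proof.
move=> hU hV h.
have := @unitary_diag_map _ n U V _ _ (fun z => (f (complex.Re z))%:C%C) hU hV h.
have E (g : 'I_n -> R) : (\row_i (f (complex.Re ((\row_j (g j)%:C%C : 'rV[C]_n) 0 i)))%:C%C)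
   = \row_i (f (g i))%:C%C :> 'rV[C]_n.
  by apply/matrixP => i j; rewrite !mxE.
by rewrite !E.
Qed.

(** Nothing explicit is known about [spectralmx A]; this allows the calculus to be evaluated in any
    diagonalization at hand, such as the rotation used in [mpow_spec2]. *)
Lemma fcm_unique n (A U : 'M[C]_n) d f : U \is unitarymx -> A = cdiag U d ->
  hermmx A -> fcm f A = cdiag U (fun i => f (d i)).
Proof.
move=> hU hA hh; have hA2 := spectral_herm hh; rewrite /fcm.
have h : cdiag (spectralmx A) (eigv A) = cdiag U d by exact: etrans (esym hA2) hA.
exact: (cdiag_map f (spectral_unitarymx A) hU h).
Qed.

Lemma cdiag_herm n (U : 'M[C]_n) d : hermmx (cdiag U d).
Proof.
apply: herm_congr; rewrite /hermmx; apply/matrixP => i j; rewrite !mxE.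
rewrite rmorphMn /= conjCE conjc_real eq_sym.
by case: eqP => [->|].
Qed.
Lemma fcm_herm n f (A : 'M[C]_n) : hermmx (fcm f A).
Proof. exact: cdiag_herm. Qed.

Lemma fcm_id n (A : 'M[C]_n) : hermmx A -> fcm id A = A.
Proof. by move/spectral_herm => {2}->. Qed.
Lemma fcm_comp n f g (A : 'M[C]_n) : fcm g (fcm f A) = fcm (fun x => g (f x)) A.
Proof. by apply: fcm_unique (fcm_herm _ _); [exact: spectral_unitarymx|]. Qed.
Lemma eq_fcm n f g (A : 'M[C]_n) : (forall i, f (eigv A i) = g (eigv A i)) -> fcm f A = fcm g A.
Proof. by move=> h; rewrite /fcm; congr cdiag; apply: funext => i; apply: h. Qed.
Lemma cdiagM n (U : 'M[C]_n) d e : U \is unitarymx ->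
  cdiag U d *m cdiag U e = cdiag U (fun i => d i * e i).
Proof.
move=> hU; rewrite /cdiag !mulmxA; congr (_ *m U).
rewrite -[X in X *m diag_mx _]mulmxA (elimT unitarymxP hU) mulmx1 -mulmxA; congr (_ *m _).
by rewrite mul_diag_mx; apply/matrixP => i j; rewrite !mxE mulrnAr rmorphM.
Qed.
Lemma fcm_mul n f g (A : 'M[C]_n) : fcm f A *m fcm g A = fcm (fun x => f x * g x) A.
Proof. exact/cdiagM/spectral_unitarymx. Qed.
Lemma cdiagD n (U : 'M[C]_n) d e : cdiag U d + cdiag U e = cdiag U (fun i => d i + e i).
Proof.
rewrite /cdiag -mulmxDl -mulmxDr.
pose x : 'rV[C]_n := \row_i (d i)%:C%C; pose y : 'rV[C]_n := \row_i (e i)%:C%C.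
have h : x + y = \row_i (d i + e i)%:C%C by apply/matrixP => i j; rewrite !mxE rmorphD.
have h2 : diag_mx x + diag_mx y = diag_mx (x + y) by rewrite raddfD.
exact: (congr1 (fun z => U^t* *m z *m U) (etrans h2 (congr1 (@diag_mx _ _) h))).
Qed.
Lemma cdiag_cst n (U : 'M[C]_n) k : U \is unitarymx -> cdiag U (fun=> k) = (k%:C%C)%:M.
Proof.
move=> hU; rewrite /cdiag.
have -> : diag_mx (\row_i (k%:C%C)) = (k%:C%C)%:M :> 'M[C]_n.
  by apply/matrixP => i j; rewrite !mxE.
rewrite mul_mx_scalar -scalemxAl -invmx_unitary // mulVmx ?unitarymx_unit //.
by rewrite scalemx1.
Qed.
Lemma fcm_cst n k (A : 'M[C]_n) : fcm (fun=> k) A = (k%:C%C)%:M.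
Proof. exact/cdiag_cst/spectral_unitarymx. Qed.
Lemma fcm_shift n f (A : 'M[C]_n) e : hermmx A ->
  fcm f (A + (e%:C%C)%:M) = fcm (fun x => f (x + e)) A.
Proof.
move=> hA; have hU := spectral_unitarymx A.
apply: (fcm_unique _ hU); last exact/hermD/herm_scalar.
by rewrite {1}(spectral_herm hA) -(cdiag_cst e hU) cdiagD.
Qed.

Lemma qform_cdiag n (U : 'M[C]_n) d v :
  qform (cdiag U d) v = \sum_i nrm2 ((U *m v) i 0) * d i.
Proof.
rewrite /cdiag qform_congr /qform /bform mul_mx_diag mxE Re_sum.
apply: eq_bigr => i _; rewrite !mxE mulrAC mulJ_nrm2 /=; simpc; by [].
Qed.
Lemma qform_fcm n f (A : 'M[C]_n) v : qform (fcm f A) v = \sum_i wt A v i * f (eigv A i).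
Proof. exact: qform_cdiag. Qed.
Lemma wt_ge0 n (A : 'M[C]_n) v i : 0 <= wt A v i. Proof. exact: nrm2_ge0. Qed.
Lemma qform1_wt n (A : 'M[C]_n) v : qform 1%:M v = \sum_i wt A v i.
Proof.
have -> : 1%:M = fcm (fun=> 1) A by rewrite fcm_cst.
by rewrite qform_fcm; apply: eq_bigr => i _; rewrite mulr1.
Qed.
Lemma qform_wt n (A : 'M[C]_n) v : hermmx A -> qform A v = \sum_i wt A v i * eigv A i.
Proof. by move=> hA; rewrite -{1}(fcm_id hA) qform_fcm. Qed.

Lemma fcm_le n f g (A : 'M[C]_n) v : (forall i, f (eigv A i) <= g (eigv A i)) ->
  qform (fcm f A) v <= qform (fcm g A) v.
Proof. by move=> h; rewrite !qform_fcm; apply: ler_sum => i _; rewrite ler_wpM2l ?wt_ge0. Qed.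

Definition eigvec n (A : 'M[C]_n) (i : 'I_n) : 'cV[C]_n := (spectralmx A)^t* *m delta_mx i 0.

Lemma mul_eigvec n (A : 'M[C]_n) i : spectralmx A *m eigvec A i = delta_mx i 0.
Proof. by rewrite /eigvec mulmxA (elimT unitarymxP (spectral_unitarymx A)) mul1mx. Qed.
Lemma eigvec_neq0 n (A : 'M[C]_n) i : eigvec A i != 0.
Proof.
apply/eqP => /(congr1 (fun x => spectralmx A *m x)); rewrite mul_eigvec mulmx0.
by move/matrixP/(_ i 0)/eqP; rewrite !mxE !eqxx oner_eq0.
Qed.
Lemma eigvecP n (A : 'M[C]_n) i : hermmx A -> A *m eigvec A i = ((eigv A i)%:C%C) *: eigvec A i.
Proof.
move=> hA.
have -> : A *m eigvec A i = cdiag (spectralmx A) (eigv A) *m eigvec A i by rewrite -spectral_herm.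
have h : diag_mx (\row_j ((eigv A j)%:C)%C) *m delta_mx i 0 =
    ((eigv A i)%:C%C) *: (delta_mx i 0 : 'cV[C]_n).
  rewrite mul_diag_mx; apply/matrixP => j k; rewrite !mxE.
  by case: eqP => [->|]; rewrite ?mulr0.
have h2 : diag_mx (\row_j ((eigv A j)%:C)%C) *m (spectralmx A *m eigvec A i) =
    ((eigv A i)%:C%C) *: (delta_mx i 0 : 'cV[C]_n).
  exact: etrans (congr1 _ (mul_eigvec A i)) h.
have h3 := congr1 (mulmx ((spectralmx A)^t*)) h2.
have h4 : cdiag (spectralmx A) (eigv A) *m eigvec A i = (spectralmx A)^t* *m
   (diag_mx (\row_j ((eigv A j)%:C)%C) *m (spectralmx A *m eigvec A i)) by rewrite /cdiag !mulmxA.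
by apply: (etrans h4 (etrans h3 _)); rewrite -scalemxAr.
Qed.
Lemma qform_eigvec n (A : 'M[C]_n) i : hermmx A -> qform A (eigvec A i) = eigv A i * qform 1%:M (eigvec A i).
Proof.
by move=> hA; rewrite /qform -{1}[A]mul1mx bformMr eigvecP // bformZv.
Qed.
Lemma psd_eigv n (A : 'M[C]_n) i : psdmx A -> 0 <= eigv A i.
Proof.
move=> /psdP[hA /(_ (eigvec A i))]; rewrite qform_eigvec // pmulr_lge0 //.
exact/qform1_gt0/eigvec_neq0.
Qed.
Lemma pd_eigv n (A : 'M[C]_n) i : pdmx A -> 0 < eigv A i.
Proof.
move=> /pdP[hA /(_ (eigvec A i) (eigvec_neq0 _ _))]; rewrite qform_eigvec // pmulr_lgt0 //.
exact/qform1_gt0/eigvec_neq0.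
Qed.
Lemma fcm_psd n f (A : 'M[C]_n) : (forall i, 0 <= f (eigv A i)) -> psdmx (fcm f A).
Proof.
move=> h; apply/psdP; split; first exact: fcm_herm.
by move=> v; rewrite qform_fcm sumr_ge0 // => i _; rewrite mulr_ge0 ?wt_ge0.
Qed.
Lemma fcm_pd n f (A : 'M[C]_n) : (forall i, 0 < f (eigv A i)) -> pdmx (fcm f A).
Proof.
move=> h; apply/pdP; split; first exact: fcm_herm.
move=> v /qform1_gt0; rewrite (qform1_wt A) => hv.
rewrite qform_fcm lt_def sumr_ge0 ?andbT => [|i _]; last by rewrite mulr_ge0 ?wt_ge0 // ltW.
apply: contraTneq hv => /psumr_eq0P h0; rewrite big1 ?ltxx // => i _.
apply/eqP; have /eqP := h0 (fun i _ => mulr_ge0 (wt_ge0 _ _ i) (ltW (h i))) i isT.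
by rewrite mulf_eq0 (gt_eqF (h i)) orbF.
Qed.

End Calculus.

(** * Scalar inequalities for real powers *)

Section ScalarPowers.
Variable R : realType.

(** Young's inequality for the product of [x^r] and 1 with conjugate exponents [1/r] and [1/(1-r)].
    The endpoints of [r], where one exponent would be infinite, are treated apart. *)
Lemma powR_le_tangent (x r : R) : 0 <= x -> 0 <= r <= 1 -> powR x r <= 1 + r * (x - 1).
Proof.
move=> x0 /andP[r0 r1].
have [->|xn0] := eqVneq x 0.
  have [->|rn0] := eqVneq r 0; first by rewrite powRr0; lra.
  by rewrite powR0 //; lra.
have {xn0}x0 : 0 < x by rewrite lt_def xn0.
have [->|rn1] := eqVneq r 1; first by rewrite powRr1 ?(ltW x0) //; lra.
have [->|rn0] := eqVneq r 0; first by rewrite powRr0; lra.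
have r0' : 0 < r by rewrite lt_def rn0.
have r1' : 0 < 1 - r by rewrite subr_gt0 lt_def eq_sym rn1.
have := @conjugate_powR _ (powR x r) 1 r^-1 (1 - r)^-1 (powR_ge0 _ _) ler01.
rewrite !invr_gt0 !invrK mulr1 -powRrM mulfV // powRr1 ?(ltW x0) // powR1 mul1r.
by move=> /(_ r0' r1'); lra.
Qed.

(** [x^r = exp (r ln x) >= 1 + r ln x], and [ln x <= x - 1] is reversed by the factor [r <= 0]. *)
Lemma powR_ge_tangent_neg (x r : R) : 0 < x -> r <= 0 -> 1 + r * (x - 1) <= powR x r.
Proof.
move=> x0 r0; have -> : powR x r = expR (r * ln x) by rewrite /powR gt_eqF.
apply: le_trans (expR_ge1Dx _); rewrite lerD2l ler_wnM2l //.
have := @le_ln1Dx _ (x - 1); rewrite (addrC 1) subrK; apply; lra.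
Qed.

(** A number [y / (x + e)] in [[0, 1]] is at most its [r]-th power; add the cases [y = x] and
    [y = e]. The excess [e^r] does not depend on [x], hence is uniform over a spectrum. *)
Lemma powR_subadd (x e r : R) : 0 <= x -> 0 < e -> 0 < r <= 1 ->
  powR (x + e) r <= powR x r + powR e r.
Proof.
move=> x0 e0 /andP[r0 r1].
have s0 : 0 < x + e by lra.
have h (y : R) : 0 <= y <= x + e -> y / (x + e) * powR (x + e) r <= powR y r.
  move=> /andP[y0 y1].
  have -> : powR y r = powR (y / (x + e)) r * powR (x + e) r.
    rewrite -powRM ?divr_ge0 ?(ltW s0) //; congr (powR _ _).
    by rewrite divfK // gt_eqF.
  rewrite ler_wpM2r ?powR_ge0 //.
  have [->|yn0] := eqVneq y 0; first by rewrite mul0r powR_ge0.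
  rewrite ger1_powR // divr_gt0 ?lt_def ?yn0 ?y0 //=; last by lra.
  by rewrite ler_pdivrMr // mul1r.
have h1 := h x; have h2 := h e.
apply: le_trans (lerD (h1 _) (h2 _)); [|lra|lra].
by rewrite -mulrDl -mulrDl divff ?gt_eqF // mul1r.
Qed.

Lemma cvg_sum_fun (T : Type) (F : set_system T) (FF : Filter F) (I : Type) (s : seq I)
    (f : I -> T -> R) (l : I -> R) :
  (forall i, (f i @ F --> l i)%classic) ->
  ((fun t => \sum_(i <- s) f i t) @ F --> \sum_(i <- s) l i)%classic.
Proof.
move=> h; elim: s => [|i s IH].
  rewrite big_nil (_ : (fun t => _) = fun=> 0); first exact: cvg_cst.
  by apply: funext => t; rewrite big_nil.
rewrite big_cons (_ : (fun t => _) = f i \+ (fun t => \sum_(i <- s) f i t)).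
  exact: cvgD.
by apply: funext => t; rewrite big_cons.
Qed.

Lemma powR_cvg_exponent (x r : R) : 0 < x -> (powR x t @[t --> r] --> powR x r)%classic.
Proof.
move=> x0; rewrite /powR gt_eqF //.
have h : (t * ln x @[t --> r] --> r * ln x)%classic by apply: cvgMr_tmp; exact: cvg_id.
have h2 := @continuous_expR R (r * ln x).
exact: cvg_comp h h2.
Qed.

End ScalarPowers.

(** * Powers of positive matrices *)

Section MatrixPowers.
Variable R : realType.
Local Notation C := (R[i]).

(* Without the lock, failing unification attempts unfold [mxpowR] and cost minutes. *)
Definition mpow n (A : 'M[C]_n) (t : R) : 'M[C]_n := locked (@mxpowR R) n A t.
Lemma mpowE n (A : 'M[C]_n) t : mxpowR A t = mpow A t.
Proof. by rewrite /mpow -lock. Qed.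
Lemma mpow_fcm n (A : 'M[C]_n) t : mpow A t = fcm (fun x => powR x t) A.
Proof. by rewrite -mpowE mxpowRE. Qed.
Lemma mpow_herm n (A : 'M[C]_n) t : hermmx (mpow A t).
Proof. rewrite mpow_fcm; exact: fcm_herm. Qed.
Lemma mpow_psd n (A : 'M[C]_n) t : psdmx (mpow A t).
Proof. by rewrite mpow_fcm; apply: fcm_psd => i; apply: powR_ge0. Qed.
Lemma mpow_pd n (A : 'M[C]_n) t : pdmx A -> pdmx (mpow A t).
Proof. by move=> hA; rewrite mpow_fcm; apply: fcm_pd => i; rewrite powR_gt0 // pd_eigv. Qed.
Lemma mpowM n (A : 'M[C]_n) s t : mpow (mpow A s) t = mpow A (s * t).
Proof. by rewrite !mpow_fcm fcm_comp; apply: eq_fcm => i; rewrite powRrM. Qed.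
Lemma mpowD n (A : 'M[C]_n) s t : pdmx A -> mpow A s *m mpow A t = mpow A (s + t).
Proof.
move=> hA; rewrite !mpow_fcm fcm_mul; apply: eq_fcm => i.
by rewrite powRD //; apply/implyP => _; rewrite gt_eqF // pd_eigv.
Qed.
Lemma mpow0 n (A : 'M[C]_n) : mpow A 0 = 1%:M.
Proof. by rewrite mpow_fcm (_ : (fun x : R => _) = fun=> 1) ?fcm_cst //; apply: funext => x; rewrite powRr0. Qed.
Lemma mpow1 n (A : 'M[C]_n) : psdmx A -> mpow A 1 = A.
Proof.
move=> hA; rewrite mpow_fcm -[RHS]fcm_id; last exact: psd_herm.
by apply: eq_fcm => i; rewrite powRr1 // psd_eigv.
Qed.
Lemma mpowNK n (A : 'M[C]_n) t : pdmx A -> mpow A (- t) *m mpow A t = 1%:M.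
Proof. by move=> hA; rewrite mpowD // addNr mpow0. Qed.
Lemma mpowKN n (A : 'M[C]_n) t : pdmx A -> mpow A t *m mpow A (- t) = 1%:M.
Proof. by move=> hA; rewrite mpowD // addrN mpow0. Qed.
Lemma bform_herml n (A T : 'M[C]_n) u v : hermmx T -> bform A (T *m u) v = bform (T *m A) u v.
Proof. by move=> hT; rewrite /bform adjM hT !mulmxA. Qed.

Lemma qform_mpow n (A : 'M[C]_n) s t v : pdmx A ->
  qform (mpow A s) (mpow A t *m v) = qform (mpow A (t + s + t)) v.
Proof.
move=> hA; rewrite /qform bform_herml; last exact: mpow_herm.
by rewrite -bformMr !mpowD.
Qed.

(* [0 <= |A^(r/2) u - A^(s/2) v|^2]; this is positivity of the block matrix
   [[A^r, A^m], [A^m, A^s]] for [m = (r + s) / 2]. *)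
Lemma mpow_young n (A : 'M[C]_n) r s u v : pdmx A ->
  2 * bform (mpow A ((r + s) / 2)) u v <= qform (mpow A r) u + qform (mpow A s) v.
Proof.
move=> hA; have hh := mpow_herm A.
have h1 : hermmx (1%:M : 'M[C]_n) by exact: (herm_scalar n 1).
set x := mpow A (r / 2) *m u; set y := mpow A (s / 2) *m v.
have h0 : 0 <= qform 1%:M (x + (-1)%:C%C *: y).
  by rewrite qform1 sumr_ge0 // => i _; apply: nrm2_ge0.
move: h0; rewrite /qform bformDu !bformDv !bformZu !bformZv (bform_herm y x h1).
have e (p q : R) w z : bform 1%:M (mpow A p *m w) (mpow A q *m z) = bform (mpow A (p + q)) w z.
  by rewrite (bform_herml _ _ _ (hh p)) mulmx1 -bformMr mpowD.
rewrite !e -!mulrDl.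
have -> : (r + r) / 2 = r by field.
have -> : (s + s) / 2 = s by field.
clear; move: (bform _ u u) (bform _ u v) (bform _ v v) => p q w; lra.
Qed.

End MatrixPowers.

(** * Operator concavity of [x^r] *)

Section OperatorConcavity.
Variable R : realType.
Local Notation C := (R[i]).

(* The hypothesis is [(1 - a) X + a Y <= Z] rather than an equality, so that the case
   [X = Y] gives monotonicity. *)
Definition concave_exponent (r : R) := forall n (X Y Z : 'M[C]_n) (a : R),
  0 <= a <= 1 -> pdmx X -> pdmx Y -> pdmx Z ->
  (forall v, (1 - a) * qform X v + a * qform Y v <= qform Z v) ->
  forall v, (1 - a) * qform (mpow X r) v + a * qform (mpow Y r) v <= qform (mpow Z r) v.

Lemma concave_exponent0 : concave_exponent 0.
Proof. by move=> n X Y Z a _ _ _ _ _ v; rewrite !mpow0 -mulrDl subrK mul1r. Qed.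

Lemma concave_exponent1 : concave_exponent 1.
Proof. by move=> n X Y Z a _ /pd_psd hX /pd_psd hY /pd_psd hZ h v; rewrite !mpow1. Qed.

Lemma qform_le1 n (H : 'M[C]_n) v : hermmx H -> (forall i, eigv H i <= 1) ->
  qform H v <= qform 1%:M v.
Proof.
move=> hH h; rewrite (qform_wt _ hH) (qform1_wt H); apply: ler_sum => i _.
by rewrite ler_piMr ?wt_ge0.
Qed.

(** Averaging the positive blocks of [mpow_young] for [X] and [Y], and enlarging the diagonal by the
    two hypotheses, makes [[[Z^r, W], [W, Z^s]]] positive, where [W = (1 - a) X^m + a Y^m]. Since
    [Z^m] is the largest Hermitian off-diagonal block with this property, [W <= Z^m]; this is proved
    by showing that the eigenvalues of [Z^(-m/2) W Z^(-m/2)] are at most 1. *)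
Lemma concave_exponent_mid r s :
  concave_exponent r -> concave_exponent s -> concave_exponent ((r + s) / 2).
Proof.
move=> gr gs n X Y Z a a01 hX hY hZ hle v.
have [a0 a1] : 0 <= a /\ 0 <= 1 - a by move/andP: a01 => [? ?]; split => //; rewrite subr_ge0.
set m := (r + s) / 2.
have [W [hW hWq hWle]] : exists W : 'M[C]_n, [/\ hermmx W,
    forall v, qform W v = (1 - a) * qform (mpow X m) v + a * qform (mpow Y m) v &
    forall u y, 2 * bform W u y <= qform (mpow Z r) u + qform (mpow Z s) y].
  exists ((1 - a)%:C%C *: mpow X m + a%:C%C *: mpow Y m); split.
  - by apply: hermD; apply: hermZ; apply: mpow_herm.
  - by move=> w; rewrite qformD !qformZ.
  move=> u y; have ry := gr n X Y Z a a01 hX hY hZ hle u.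
  have sy := gs n X Y Z a a01 hX hY hZ hle y.
  apply: le_trans (lerD ry sy).
  rewrite bformDl !bformZl.
  have := ler_wpM2l a1 (mpow_young r s u y hX).
  have := ler_wpM2l a0 (mpow_young r s u y hY).
  rewrite -/m; clear.
  move: (bform _ u y) (bform (mpow Y m) u y) (qform _ u) (qform _ y) (qform _ u) (qform _ y).
  move=> *; lra.
have [T [S [hT hS ST TS SS]]] : exists T S : 'M[C]_n,
    [/\ hermmx T, hermmx S, S *m T = 1%:M, T *m S = 1%:M & S *m S = mpow Z m].
  exists (mpow Z (- (m / 2))), (mpow Z (m / 2)); split; try exact: mpow_herm.
  - exact: mpowKN.
  - exact: mpowNK.
  - by rewrite mpowD //; congr mpow; field.
have hH : hermmx (T *m W *m T) by rewrite -{1}hT; apply: herm_congr.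
have [H eH] : exists H, H = T *m W *m T by exists (T *m W *m T).
rewrite -eH in hH.
have lH i : eigv H i <= 1.
  (* For an eigenvector [y'] of [H] with eigenvalue [l], the vector [y = T y'] satisfies
     [W y = l Z^m y]; testing [hWle] on [u = Z^(m-r) y] gives [2 l <= 2]. *)
  have [y' y'0 ey'] : exists2 y' : 'cV[C]_n, y' != 0 & H *m y' = ((eigv H i)%:C%C) *: y'.
    by exists (eigvec H i); [exact: eigvec_neq0|exact: eigvecP].
  have [y ey] : exists y, y = T *m y' by exists (T *m y').
  have Sy : S *m y = y' by rewrite ey mulmxA ST mul1mx.
  have y0 : y != 0 by apply: contraNneq y'0 => h; rewrite -Sy h mulmx0.
  have Wy : W *m y = ((eigv H i)%:C%C) *: (mpow Z m *m y).
    have h1 : T *m (W *m y) = ((eigv H i)%:C%C) *: y' by rewrite -ey' eH ey !mulmxA.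
    have h2 : S *m (T *m (W *m y)) = W *m y by rewrite mulmxA ST mul1mx.
    rewrite -SS -mulmxA Sy -h2 h1; exact: esym (scalemxAr _ _ _).
  have := hWle (mpow Z (m - r) *m y) y.
  have -> : bform W (mpow Z (m - r) *m y) y = eigv H i * qform (mpow Z s) y.
    have -> : bform W (mpow Z (m - r) *m y) y = bform 1%:M (mpow Z (m - r) *m y) (W *m y).
      by rewrite -bformMr mul1mx.
    rewrite Wy bformZv -bformMr mul1mx; congr (_ * _).
    rewrite bform_herml; last exact: mpow_herm.
    have es : m - r + m = s by rewrite /m; field.
    by rewrite (mpowD _ _ hZ) es.
  rewrite qform_mpow //.
  have -> : m - r + r + (m - r) = s by rewrite /m; field.
  have q0 : 0 < qform (mpow Z s) y by move/pdP: (mpow_pd s hZ) => [_]; apply.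
  move: (qform _ y) q0 => q q0 h.
  by rewrite -(ler_pM2r q0) mul1r; clear -h; lra.
rewrite -hWq.
have hTx : T *m (S *m v) = v by rewrite mulmxA TS mul1mx.
have -> : qform W v = qform H (S *m v) by rewrite eH -{1}hT qform_congr hTx.
have -> : qform (mpow Z m) v = qform 1%:M (S *m v).
  by rewrite -SS -{1}hS -[S^t*]mulmx1 qform_congr.
exact: qform_le1.
Qed.

(** As [j] is the sum of [j./2] and [uphalf j], the dyadic number [j / 2^(k+1)] is the midpoint of
    two dyadic numbers of level [k]. *)
Lemma concave_exponent_dyadic k j : (j <= 2 ^ k)%N ->
  concave_exponent (j%:R / 2 ^+ k).
Proof.
elim: k j => [|k IH] j.
  rewrite expn0 expr0 divr1; case: j => [|[|]] // _; first exact: concave_exponent0.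
  exact: concave_exponent1.
move=> hj.
have hl : (j./2 <= 2 ^ k)%N.
  by rewrite -leq_double -mul2n -mul2n -expnS (leq_trans _ hj) // mul2n -[leqRHS]odd_double_half leq_addl.
have hr : (uphalf j <= 2 ^ k)%N.
  by rewrite leq_uphalf_double -mul2n -expnS.
have := concave_exponent_mid (IH _ hl) (IH _ hr).
rewrite -mulrDl -natrD addnC uphalf_half -addnA addnn odd_double_half.
have -> : j%:R / 2 ^+ k / 2 = j%:R / 2 ^+ k.+1 :> R by rewrite exprSr invfM mulrA.
exact.
Qed.

Lemma cvg_qform_mpow n (A : 'M[C]_n) v r : pdmx A ->
  (qform (mpow A t) v @[t --> r] --> qform (mpow A r) v)%classic.
Proof.
move=> hA; rewrite (_ : (fun t => _) = fun t => \sum_i wt A v i * powR (eigv A i) t); last first.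
  by apply: funext => t; rewrite mpow_fcm qform_fcm.
rewrite mpow_fcm qform_fcm; apply: cvg_sum_fun => i.
by apply: cvgMl_tmp; apply: powR_cvg_exponent; apply: pd_eigv.
Qed.

Lemma concave_exponent_unit r : 0 <= r <= 1 -> concave_exponent r.
Proof.
move=> /andP[r0 r1] n X Y Z a a01 hX hY hZ hle v.
rewrite leNgt; apply/negP => hlt.
pose g t := qform (mpow Z t) v - ((1 - a) * qform (mpow X t) v + a * qform (mpow Y t) v).
have gc : (g t @[t --> r] --> g r)%classic.
  apply: cvgB; first exact: cvg_qform_mpow.
  by apply: cvgD; apply: cvgMl_tmp; apply: cvg_qform_mpow.
have gr : g r < 0 by rewrite subr_lt0.
have /nbhs_ballP[e /= e0 he] : \forall t \near r, g t < 0 by apply: (cvgr_lt _ gc).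
(* A failure at [r] persists on a ball of radius [e]. With [2^-k < e], the truncation of [r] at
   level [k] lies in that ball; rounding down keeps [j <= 2^k]. *)
have [k hk] : exists k, e^-1 < 2 ^+ k.
  have := @Num.Theory.truncnS_gt R e^-1; set k := Num.truncn _ => h.
  exists k.+1; apply: lt_le_trans h _; rewrite -natrX ler_nat ltnW //; exact: ltn_expl.
set j := Num.truncn (r * 2 ^+ k).
have p2 : 0 < 2 ^+ k :> R by rewrite exprn_gt0.
have /andP[j1 j2] : j%:R <= r * 2 ^+ k < j.+1%:R.
  by apply: truncn_itv; rewrite mulr_ge0 // ltW.
have jk : (j <= 2 ^ k)%N.
  rewrite -(ler_nat R) natrX (le_trans j1) // ler_piMl // ltW //.
have := concave_exponent_dyadic jk a01 hX hY hZ hle v; rewrite leNgt => /negP; apply.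
rewrite -subr_lt0; apply: he => /=; rewrite /ball /= ger0_norm.
  rewrite ltrBlDr -ltrBlDl ltr_pdivlMr //.
  have := hk; rewrite -(ltr_pM2l e0) divff ?gt_eqF // => h.
  move: j2 h; rewrite -natr1 mulrBl; clear; lra.
by rewrite subr_ge0 ler_pdivrMr.
Qed.

Lemma le_of_le_add_vanishing (x y c : R) (f : R -> R) :
  (forall e, 0 < e -> x <= y + f e * c) -> (f e @[e --> 0^'+] --> 0)%classic -> x <= y.
Proof.
move=> h hf.
have hc : (y + f e * c @[e --> 0^'+] --> y)%classic.
  rewrite -[X in (_ --> X)%classic]addr0 -{2}(mul0r c).
  by apply: cvgD; [exact: cvg_cst|exact: cvgMr_tmp].
apply: (cvgr_to_ge hc); near=> e; apply: h.
by near: e; exact: nbhs_right_gt.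
Unshelve. all: by end_near.
Qed.

Lemma pd_shift n (A : 'M[C]_n) e : psdmx A -> 0 < e -> pdmx (A + (e%:C%C)%:M).
Proof.
move=> /psdP[hA pA] e0; apply/pdP; split; first exact/hermD/herm_scalar.
move=> v /qform1_gt0 v0; rewrite qformD qform_scalar.
by rewrite ltr_wpDl // mulr_gt0.
Qed.

(** Adding [e] to all three matrices preserves the hypothesis because the weights sum to 1. On the
    left the powers only grow, and on the right [powR_subadd] bounds the excess by [e^r |v|^2],
    which vanishes as [r > 0]. So no continuity of matrix powers at singular matrices is invoked. *)
Theorem powR_operator_concave n (X Y Z : 'M[C]_n) a r :
  0 <= a <= 1 -> 0 < r <= 1 -> psdmx X -> psdmx Y -> psdmx Z ->
  (forall v, (1 - a) * qform X v + a * qform Y v <= qform Z v) ->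
  forall v, (1 - a) * qform (mpow X r) v + a * qform (mpow Y r) v <= qform (mpow Z r) v.
Proof.
move=> a01 /andP[r0 r1] hX hY hZ hle v.
apply: (@le_of_le_add_vanishing _ _ (qform 1%:M v) (fun e => powR e r)); last exact: powR_cvg0.
move=> e e0.
have [a0 a1] : 0 <= a /\ 0 <= 1 - a by move/andP: a01 => [? ?]; split => //; rewrite subr_ge0.
have hge (A : 'M[C]_n) : psdmx A ->
    qform (mpow A r) v <= qform (mpow (A + (e%:C%C)%:M) r) v.
  move=> hA; rewrite !mpow_fcm fcm_shift; last exact: psd_herm.
  apply: fcm_le => i; apply: ge0_ler_powR; rewrite ?nnegrE ?psd_eigv ?(ltW r0) //.
    by rewrite addr_ge0 ?psd_eigv ?ltW.
  by rewrite lerDl ltW.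
have hup : qform (mpow (Z + (e%:C%C)%:M) r) v <= qform (mpow Z r) v + powR e r * qform 1%:M v.
  have -> : qform (mpow Z r) v + powR e r * qform 1%:M v =
      qform (fcm (fun x => powR x r + powR e r) Z) v.
    by rewrite -qform_scalar -(fcm_cst _ Z) mpow_fcm -qformD /fcm cdiagD.
  rewrite mpow_fcm fcm_shift; last exact: psd_herm.
  by apply: fcm_le => i; apply: powR_subadd; rewrite ?psd_eigv // r0.
apply: le_trans hup.
apply: le_trans (concave_exponent_unit _ a01 (pd_shift hX e0) (pd_shift hY e0) (pd_shift hZ e0) _ v).
- exact: (lerD (ler_wpM2l a1 (hge X hX)) (ler_wpM2l a0 (hge Y hY))).
- by rewrite (ltW r0).
- move=> w; have := hle w; rewrite !qformD !(qform_scalar e); clear.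
  move: (qform 1%:M w) (qform X w) (qform Y w) (qform Z w) => i x y z h.
  have -> : (1 - a) * (x + e * i) + a * (y + e * i) = (1 - a) * x + a * y + e * i by ring.
  by rewrite lerD2r.
Qed.

Corollary loewner_heinz n (X Z : 'M[C]_n) r :
  0 < r <= 1 -> psdmx X -> psdmx Z -> (forall v, qform X v <= qform Z v) ->
  forall v, qform (mpow X r) v <= qform (mpow Z r) v.
Proof.
move=> r01 hX hZ h v.
have := @powR_operator_concave n X X Z 0 r _ r01 hX hX hZ _ v.
rewrite lexx ler01 subr0 mul0r addr0 mul1r; apply => // w.
by rewrite mul0r addr0 mul1r.
Qed.

End OperatorConcavity.

(** * The inequality for [1 <= p <= q] *)

Section MeanInequality.
Variable R : realType.
Local Notation C := (R[i]).

Lemma psd_comb n (A B : 'M[C]_n) (s t : R) : 0 <= s -> 0 <= t -> psdmx A -> psdmx B ->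
  psdmx (s%:C%C *: A + t%:C%C *: B).
Proof.
move=> s0 t0 /psdP[hA pA] /psdP[hB pB]; apply/psdP; split.
  by apply: hermD; apply: hermZ.
by move=> v; rewrite qformD !qformZ addr_ge0 // mulr_ge0.
Qed.

Lemma qform_powR_le n (X : 'M[C]_n) a v : 0 <= a <= 1 -> psdmx X ->
  qform (mpow X a) v <= (1 - a) * qform 1%:M v + a * qform X v.
Proof.
move=> a01 hX; rewrite mpow_fcm qform_fcm (qform1_wt X) (qform_wt _ (psd_herm hX)).
rewrite !mulr_sumr -big_split /=; apply: ler_sum => i _.
have := ler_wpM2l (wt_ge0 X v i) (powR_le_tangent (psd_eigv i hX) a01).
move=> h; apply: le_trans h _; rewrite le_eqVlt; apply/orP; left; apply/eqP; ring.
Qed.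

Lemma wgm_pdE n (A B : 'M[C]_n) a : wgm_pd A B a =
  mpow A (2^-1) *m mpow (mpow A (- 2^-1) *m B *m mpow A (- 2^-1)) a *m mpow A (2^-1).
Proof. by rewrite /wgm_pd !mpowE. Qed.

Lemma wgm_pd_psd n (A B : 'M[C]_n) a : psdmx (wgm_pd A B a).
Proof.
rewrite wgm_pdE; apply/psdP.
have [X hX] : exists X, X = mpow A (- 2^-1) *m B *m mpow A (- 2^-1) by eexists.
rewrite -hX -{1 3}(mpow_herm A (2^-1)); split; first exact/herm_congr/mpow_herm.
by move=> v; rewrite qform_congr; case/psdP: (mpow_psd X a).
Qed.

(** [qform_powR_le] for [A^(-1/2) B A^(-1/2)], transported by the congruence with [A^(1/2)], which
    sends the identity to [A] and this matrix back to [B]. *)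
Lemma wgm_pd_le n (A B : 'M[C]_n) a v : 0 <= a <= 1 -> pdmx A -> psdmx B ->
  qform (wgm_pd A B a) v <= (1 - a) * qform A v + a * qform B v.
Proof.
move=> a01 hA hB; rewrite wgm_pdE.
have [S [T [hS hT TS SS [eS eT]]]] : exists S T : 'M[C]_n,
    [/\ hermmx S, hermmx T, T *m S = 1%:M, S *m S = A & S = mpow A (2^-1) /\ T = mpow A (- 2^-1)].
  exists (mpow A (2^-1)), (mpow A (- 2^-1)); split => //; try exact: mpow_herm.
    exact: mpowNK.
  by rewrite mpowD // -[RHS](mpow1 (pd_psd hA)); congr mpow; field.
rewrite -eS -eT -{1}hS qform_congr -{1}hT.
have hX : psdmx (T^t* *m B *m T).
  apply/psdP; split; first exact/herm_congr/psd_herm.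
  by move=> w; rewrite qform_congr; case/psdP: hB.
apply: le_trans (qform_powR_le _ a01 hX) _.
rewrite qform_congr mulmxA TS mul1mx.
have -> : qform 1%:M (S *m v) = qform A v.
  by rewrite -SS -{2}hS -[S^t*]mulmx1 qform_congr.
by [].
Qed.

Lemma qform_entries n (A : 'M[C]_n) v : qform A v = \sum_i \sum_j
  (complex.Re ((v j 0)^* * v i 0) * complex.Re (A j i) - complex.Im ((v j 0)^* * v i 0) * complex.Im (A j i)).
Proof.
rewrite /qform /bform mxE Re_sum; apply: eq_bigr => i _.
rewrite mxE mulr_suml Re_sum; apply: eq_bigr => j _.
rewrite !mxE mulrAC; by case: (_ * v i 0) (A j i) => x y [z t].
Qed.

Lemma mx_cvg_qform n (F : R -> 'M[C]_n) L v : mx_cvg_right0 F L ->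
  (qform (F e) v @[e --> 0^'+] --> qform L v)%classic.
Proof.
move=> h; rewrite (_ : (fun e => _) = fun e => \sum_i \sum_j
  (complex.Re ((v j 0)^* * v i 0) * complex.Re (F e j i) - complex.Im ((v j 0)^* * v i 0) * complex.Im (F e j i))); last first.
  by apply: funext => e; rewrite qform_entries.
rewrite qform_entries; apply: cvg_sum_fun => i; apply: cvg_sum_fun => j.
by have [hr hi] := h j i; apply: cvgB; apply: cvgMl_tmp.
Qed.

(** Convergence of [qform] controls only the real part of the form, so self-adjointness of a limit
    is obtained separately, from the symmetry of real parts and the antisymmetry of imaginary
    parts. *)
Lemma mx_cvg_herm n (F : R -> 'M[C]_n) L : mx_cvg_right0 F L ->
  (forall e, hermmx (F e)) -> hermmx L.
Proof.
move=> h hF; apply/matrixP => i j; rewrite !mxE.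
have [rij iij] := h i j; have [rji iji] := h j i.
have eF e : F e j i = (F e i j)^*.
  by have /matrixP/(_ j i) := hF e; rewrite !mxE => ->.
have er : complex.Re (L j i) = complex.Re (L i j).
  have f : (fun e => complex.Re (F e j i)) = fun e => complex.Re (F e i j).
    by apply: funext => e; rewrite eF; case: (F e i j).
  rewrite f in rji; exact: (cvg_unique (@Rhausdorff R) rji rij).
have ei : complex.Im (L j i) = - complex.Im (L i j).
  have f : (fun e => complex.Im (F e j i)) = fun e => - complex.Im (F e i j).
    by apply: funext => e; rewrite eF; case: (F e i j).
  rewrite f in iji; exact: (cvg_unique (@Rhausdorff R) iji (cvgN iij)).
by move: er ei; rewrite conjCE; case: (L j i) (L i j) => x y [z t] /= -> ->; rewrite opprK.
Qed.

(* If the limit defining [wgm] did not exist, [xget] would return [0], which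
   satisfies both bounds, so convergence need not be proved. *)
Lemma wgm_bounds n (A B : 'M[C]_n) a : 0 <= a <= 1 -> psdmx A -> psdmx B ->
  psdmx (wgm A B a) /\ forall v, qform (wgm A B a) v <= (1 - a) * qform A v + a * qform B v.
Proof.
move=> a01 hA hB.
have [a0 a1] : 0 <= a /\ 0 <= 1 - a by move/andP: a01 => [? ?]; split => //; rewrite subr_ge0.
rewrite /wgm; case: asboolP => [[pA pB]|_].
  by split; [exact: wgm_pd_psd|move=> v; exact: wgm_pd_le].
case: xgetP => [L _ hL|_]; last first.
  have q0 v : qform (0 : 'M[C]_n) v = 0 by rewrite /qform /bform mulmx0 mul0mx mxE.
  split; first by move=> v; rewrite mulmx0 mul0mx mxE.
  move=> v; rewrite q0 addr_ge0 // mulr_ge0 //; [by case/psdP: hA|by case/psdP: hB].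
rewrite /= in hL.
split.
  apply/psdP; split.
    by apply: mx_cvg_herm hL _ => e; apply/psd_herm/wgm_pd_psd.
  move=> v; have hc := @mx_cvg_qform _ _ _ v hL; apply: (cvgr_to_ge hc).
  by near=> e; case/psdP: (wgm_pd_psd (A + (e%:C%C)%:M) (B + (e%:C%C)%:M) a).
move=> v.
(* Shifting both matrices by [e] raises the bound by exactly [e |v|^2], the weights having sum 1. *)
have hc : (((1 - a) * qform A v + a * qform B v) + e * qform 1%:M v @[e --> 0^'+] -->
    (1 - a) * qform A v + a * qform B v)%classic.
  rewrite -[X in (_ --> X)%classic]addr0 -{2}(mul0r (qform 1%:M v)).
  apply: cvgD; [exact: cvg_cst|apply: cvgMr_tmp].
  exact: cvg_within.
apply: (ler_cvg_to (@mx_cvg_qform _ _ _ v hL) hc).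
near=> e.
have e0 : 0 < e by near: e; exact: nbhs_right_gt.
apply: le_trans (wgm_pd_le _ a01 (pd_shift hA e0) (pd_psd (pd_shift hB e0))) _.
rewrite !qformD !(qform_scalar e).
move: (qform 1%:M v) (qform A v) (qform B v) => i x y.
by rewrite le_eqVlt; apply/orP; left; apply/eqP; ring.
Unshelve. all: by end_near.
Qed.

Theorem Gmean_le_Amean n (A B : 'M[C]_n) a p q : 0 <= a <= 1 -> 1 <= p <= q ->
  psdmx A -> psdmx B -> loewner_le (Gmean a p A B) (Amean a q A B).
Proof.
move=> a01 /andP[p1 pq] hA hB.
have p0 : 0 < p by exact: lt_le_trans p1.
have q0 : 0 < q by exact: lt_le_trans pq.
have [a0 a1] : 0 <= a /\ 0 <= 1 - a by move/andP: a01 => [? ?]; split => //; rewrite subr_ge0.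
rewrite /Gmean /Amean !mpowE.
apply/loewnerP; [exact: mpow_herm|exact: mpow_herm|].
have [N [hN hNle]] : exists N, N = wgm (mpow A p) (mpow B p) a /\
    (psdmx N /\ forall v, qform N v <= (1 - a) * qform (mpow A p) v + a * qform (mpow B p) v).
  by exists (wgm (mpow A p) (mpow B p) a); split => //; exact: wgm_bounds a01 (mpow_psd _ _) (mpow_psd _ _).
rewrite -hN; case: hNle => pN hNle.
have [M hM] : exists M, M = ((1 - a)%:C)%C *: mpow A q + (a%:C)%C *: mpow B q by eexists.
rewrite -hM.
have pM : psdmx M by rewrite hM; exact: psd_comb a1 a0 (mpow_psd _ _) (mpow_psd _ _).
(* This splits the use of the hypotheses: [p >= 1] serves to take the root [1/p], and [p <= q] to
   apply concavity with exponent [p/q]. *)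
have -> : mpow M (q^-1) = mpow (mpow M (p / q)) (p^-1).
  by rewrite mpowM; congr mpow; field; rewrite !gt_eqF.
apply: (loewner_heinz _ pN (mpow_psd _ _)); first by rewrite invr_gt0 p0 invf_le1.
move=> v; apply: le_trans (hNle v) _.
have e (D : 'M[C]_n) : mpow D p = mpow (mpow D q) (p / q).
  by rewrite mpowM; congr mpow; field; rewrite gt_eqF.
rewrite !e; apply: (powR_operator_concave a01 _ (mpow_psd _ _) (mpow_psd _ _) pM).
  by rewrite divr_gt0 //= ler_pdivrMr // mul1r.
by move=> w; rewrite hM qformD !qformZ.
Qed.

End MeanInequality.

(** * Jensen, Cauchy-Schwarz and inversion *)

Section Jensen.
Variable R : realType.
Local Notation C := (R[i]).

Lemma qform_gt0 n (A : 'M[C]_n) v : pdmx A -> v != 0 -> 0 < qform A v.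
Proof. by move=> /pdP[_]; apply. Qed.

Lemma unit_neq0 n (v : 'cV[C]_n) : qform 1%:M v = 1 -> v != 0.
Proof.
apply: contra_eq_neq => ->; rewrite qform1 big1 => [|i _]; first by rewrite eq_sym oner_neq0.
by rewrite mxE /nrm2 /= expr0n addr0.
Qed.

(** The graph of the concave [x^r] lies below its tangent at the mean [m = qform A v]. The linear
    term of the tangent integrates to 0 against the spectral weights, leaving [m^r]. In [jensen_ge]
    the power is convex and lies above its tangent. *)
Lemma jensen_le n (A : 'M[C]_n) r v : pdmx A -> 0 <= r <= 1 -> qform 1%:M v = 1 ->
  qform (mpow A r) v <= powR (qform A v) r.
Proof.
move=> hA r01 v1; have m0 := qform_gt0 hA (unit_neq0 v1).
have [m hm] : exists m, m = qform A v by eexists.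
rewrite -hm in m0 *; rewrite mpow_fcm qform_fcm.
apply: (@le_trans _ _ (\sum_i wt A v i * (powR m r * (1 + r * (eigv A i / m - 1))))).
  apply: ler_sum => i _; rewrite ler_wpM2l ?wt_ge0 //.
  have x0 := ltW (pd_eigv i hA).
  have -> : powR (eigv A i) r = powR m r * powR (eigv A i / m) r.
    rewrite -powRM ?(ltW m0) ?divr_ge0 ?(ltW m0) //; congr powR.
    by rewrite mulrC divfK // gt_eqF.
  by rewrite ler_wpM2l ?powR_ge0 // powR_le_tangent // divr_ge0 // ltW.
rewrite le_eqVlt; apply/orP; left; apply/eqP.
transitivity (powR m r * ((1 - r) * (\sum_i wt A v i) + r / m * (\sum_i wt A v i * eigv A i))).
  rewrite !mulr_sumr -big_split /= mulr_sumr; apply: eq_bigr => i _; field; exact: lt0r_neq0.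
rewrite -qform1_wt v1 -(qform_wt _ (psd_herm (pd_psd hA))) -hm divfK ?gt_eqF //.
by rewrite mulr1 subrK mulr1.
Qed.

Lemma jensen_ge n (A : 'M[C]_n) r v : pdmx A -> r <= 0 -> qform 1%:M v = 1 ->
  powR (qform A v) r <= qform (mpow A r) v.
Proof.
move=> hA r0 v1; have m0 := qform_gt0 hA (unit_neq0 v1).
have [m hm] : exists m, m = qform A v by eexists.
rewrite -hm in m0 *; rewrite mpow_fcm qform_fcm.
apply: (@le_trans _ _ (\sum_i wt A v i * (powR m r * (1 + r * (eigv A i / m - 1))))); last first.
  apply: ler_sum => i _; rewrite ler_wpM2l ?wt_ge0 //.
  have x0 := pd_eigv i hA.
  have -> : powR (eigv A i) r = powR m r * powR (eigv A i / m) r.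
    rewrite -powRM ?(ltW m0) ?divr_ge0 ?(ltW m0) ?(ltW x0) //; congr powR.
    by rewrite mulrC divfK // gt_eqF.
  by rewrite ler_wpM2l ?powR_ge0 // powR_ge_tangent_neg // divr_gt0.
rewrite le_eqVlt; apply/orP; left; apply/eqP/esym.
transitivity (powR m r * ((1 - r) * (\sum_i wt A v i) + r / m * (\sum_i wt A v i * eigv A i))).
  rewrite !mulr_sumr -big_split /= mulr_sumr; apply: eq_bigr => i _; field; exact: lt0r_neq0.
rewrite -qform1_wt v1 -(qform_wt _ (psd_herm (pd_psd hA))) -hm divfK ?gt_eqF //.
by rewrite mulr1 subrK mulr1.
Qed.

(** In [mpow_young] the exponents [-r] and [r] have midpoint 0. Scaling [u] by [b / p], the optimal
    factor, turns the sum into a product. *)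
Lemma cauchy_mpow n (A : 'M[C]_n) r u v : pdmx A ->
  bform 1%:M u v ^+ 2 <= qform (mpow A (- r)) u * qform (mpow A r) v.
Proof.
move=> hA.
have [->|u0] := eqVneq u 0.
  rewrite /bform (_ : (0 : 'cV[C]_n)^t* = 0).
    by rewrite mulmx1 mul0mx mxE /= expr0n /qform /bform mulmx0 mxE /= mul0r.
  by apply/matrixP => i j; rewrite !mxE conjC0.
have [p hp] : exists p, p = qform (mpow A (- r)) u by eexists.
have p0 : 0 < p by rewrite hp; apply: qform_gt0 u0; apply: mpow_pd.
have [b hb] : exists b, b = bform 1%:M u v by eexists.
have h : 2 * (b / p * b) <= b / p * (b / p * p) + qform (mpow A r) v.
  have := mpow_young (- r) r ((b / p)%:C%C *: u) v hA.
  rewrite addNr mul0r mpow0 bformZu -hb {1}/qform bformZu bformZv.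
  by rewrite -/(qform _ u) -hp.
rewrite -hb -hp; move: (qform _ v) h => q.
rewrite (mulrC p) -ler_pdivrMr //.
have -> : 2 * (b / p * b) = 2 * (b ^+ 2 / p) by ring.
have -> : b / p * (b / p * p) = b ^+ 2 / p by field; rewrite gt_eqF.
by clear; lra.
Qed.

(** With [s = qform (B^-1) u], Cauchy-Schwarz for [A] at [u] and [B^-1 u] gives
    [s^2 <= qform (A^-1) u * qform A (B^-1 u)], and the last factor is at most
    [qform B (B^-1 u) = s]. *)
Lemma inverse_antitone n (A B : 'M[C]_n) u : pdmx A -> pdmx B ->
  (forall v, qform A v <= qform B v) -> qform (mpow B (- 1)) u <= qform (mpow A (- 1)) u.
Proof.
move=> hA hB hle.
have [->|u0] := eqVneq u 0; first by rewrite /qform /bform !mulmx0 mxE.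
have s0 := qform_gt0 (mpow_pd (- 1) hB) u0.
set s := qform _ u in s0 *.
have h1 := cauchy_mpow 1 u (mpow B (- 1) *m u) hA.
have h2 : qform (mpow A 1) (mpow B (- 1) *m u) <= s.
  rewrite (mpow1 (pd_psd hA)); apply: le_trans (hle _) _.
  rewrite -{1}(mpow1 (pd_psd hB)) qform_mpow //.
  by rewrite (_ : - 1 + 1 + - 1 = - 1 :> R) //; ring.
have h3 : bform 1%:M u (mpow B (- 1) *m u) = s by rewrite -bformMr mul1mx.
rewrite h3 in h1.
have /psdP[_ hp] := mpow_psd A (- 1).
have := le_trans h1 (ler_wpM2l (hp u) h2).
by clear -s0; rewrite expr2 ler_pM2r.
Qed.

(** The spectral power [-1] is identified with the algebraic inverse, which unlike a general power
    commutes with congruences. *)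
Lemma mpow_congr_inv n (S T B : 'M[C]_n) : hermmx T -> S *m T = 1%:M -> T *m S = 1%:M ->
  pdmx B -> pdmx (T *m B *m T) /\ mpow (T *m B *m T) (- 1) = S *m mpow B (- 1) *m S.
Proof.
move=> hT ST TS hB.
have pX : pdmx (T *m B *m T).
  apply/pdP; split; first by rewrite -{1}hT; apply/herm_congr/psd_herm/pd_psd.
  move=> v v0; rewrite -{1}hT qform_congr qform_gt0 //.
  by apply: contraNneq v0 => h; rewrite -[v]mul1mx -ST -mulmxA h mulmx0.
split => //.
have [X hX] : exists X, X = T *m B *m T by eexists.
have [D hD] : exists D, D = S *m mpow B (- 1) *m S by eexists.
rewrite -hX -hD; rewrite -hX in pX.
have XD : X *m D = 1%:M.
  rewrite hX hD -!mulmxA (mulmxA T S) TS mul1mx (mulmxA B).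
  have -> : B *m mpow B (- 1) = 1%:M.
    by rewrite -{1}(mpow1 (pd_psd hB)) mpowD // subrr mpow0.
  by rewrite mul1mx.
have IX : mpow X (- 1) *m X = 1%:M.
  by rewrite -{2}(mpow1 (pd_psd pX)) mpowNK.
by rewrite -[D]mul1mx -IX -mulmxA XD mulmx1.
Qed.

Lemma qformZv n (s : R) (v : 'cV[C]_n) (A : 'M[C]_n) : qform A (s%:C%C *: v) = s ^+ 2 * qform A v.
Proof. by rewrite /qform bformZu bformZv mulrA. Qed.

End Jensen.

(** * The geometric mean along eigenvectors of its first argument *)

Section GeometricMeanBounds.
Variable R : realType.
Local Notation C := (R[i]).

Lemma wgm_pd_pd n (A B : 'M[C]_n) a : pdmx A -> pdmx B -> pdmx (wgm_pd A B a).
Proof.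
move=> hA hB; rewrite wgm_pdE.
have [pX _] := mpow_congr_inv (mpow_herm A (- 2^-1)) (mpowKN _ hA) (mpowNK _ hA) hB.
by have [] := mpow_congr_inv (mpow_herm A (2^-1)) (mpowNK _ hA) (mpowKN _ hA) (mpow_pd a pX).
Qed.

Lemma wgm_pd_inv n (A B : 'M[C]_n) a : pdmx A -> pdmx B ->
  mpow (wgm_pd A B a) (- 1) = mpow A (- 2^-1) *m
    mpow (mpow A (- 2^-1) *m B *m mpow A (- 2^-1)) (- a) *m mpow A (- 2^-1).
Proof.
move=> hA hB; rewrite wgm_pdE.
have [pX _] := mpow_congr_inv (mpow_herm A (- 2^-1)) (mpowKN _ hA) (mpowNK _ hA) hB.
have [_ ->] := mpow_congr_inv (mpow_herm A (2^-1)) (mpowNK _ hA) (mpowKN _ hA) (mpow_pd a pX).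
by rewrite mpowM mulrN1.
Qed.

(** The mean dominates a multiple of the projection on [e], an eigenvector of [A] for the eigenvalue
    1. With [X = A^(-1/2) B A^(-1/2)], Cauchy-Schwarz pairs [X^-a] at [e] with [X^a] at [A^(1/2) z];
    Jensen bounds the first factor through [X^-1 = A^(1/2) B^-1 A^(1/2)], whose form at [e] is that
    of [B^-1]. *)
Lemma wgm_pd_lower n (A B : 'M[C]_n) a (e z : 'cV[C]_n) : 0 <= a <= 1 -> pdmx A -> pdmx B ->
  (forall t, mpow A t *m e = e) -> qform 1%:M e = 1 ->
  bform 1%:M e z ^+ 2 <= powR (qform (mpow B (- 1)) e) a * qform (wgm_pd A B a) z.
Proof.
move=> a01 hA hB hAe e1.
rewrite wgm_pdE.
have [pX] := mpow_congr_inv (mpow_herm A (- 2^-1)) (mpowKN _ hA) (mpowNK _ hA) hB.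
have [X hX] : exists X, X = mpow A (- 2^-1) *m B *m mpow A (- 2^-1) by eexists.
rewrite -hX in pX *; move=> eX.
rewrite -{1}(mpow_herm A (2^-1)) qform_congr.
have -> : bform 1%:M e z = bform 1%:M e (mpow A (2^-1) *m z).
  rewrite -bformMr mul1mx -[in LHS](hAe (2^-1)) (bform_herml _ _ _ (mpow_herm _ _)).
  by rewrite mulmx1.
have h1 : qform (mpow X (- a)) e <= powR (qform (mpow B (- 1)) e) a.
  have -> : mpow X (- a) = mpow (mpow X (- 1)) a by rewrite mpowM mulN1r.
  apply: le_trans (jensen_le (mpow_pd (- 1) pX) a01 e1) _.
  by rewrite eX -{1}(mpow_herm A (2^-1)) qform_congr hAe.
apply: le_trans (cauchy_mpow a e _ pX) _.
have /psdP[_ h2] := mpow_psd X a.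
exact: (ler_wpM2r (h2 _) h1).
Qed.

(** Jensen for [X = A^(-1/2) B A^(-1/2)] at [v], where its form is [qform B v / x]. For [a < 1] the
    bound vanishes as [x -> 0], which is what makes the mean nearly of rank one in the first
    test. *)
Lemma wgm_pd_upper n (A B : 'M[C]_n) a x (v : 'cV[C]_n) : 0 <= a <= 1 -> pdmx A -> pdmx B -> 0 < x ->
  (forall t, mpow A t *m v = ((powR x t)%:C%C) *: v) -> qform 1%:M v = 1 ->
  qform (wgm_pd A B a) v <= powR x (1 - a) * powR (qform B v) a.
Proof.
move=> a01 hA hB x0 hAv v1.
rewrite wgm_pdE.
have [pX _] := mpow_congr_inv (mpow_herm A (- 2^-1)) (mpowKN _ hA) (mpowNK _ hA) hB.
have qX : qform (mpow A (- 2^-1) *m B *m mpow A (- 2^-1)) v = x^-1 * qform B v.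
  rewrite -{1}(mpow_herm A (- 2^-1)) qform_congr hAv qformZv; congr (_ * _).
  have -> : x^-1 = powR x (- 2^-1 * 2).
    have -> : - 2^-1 * 2 = -1 :> R by field.
    by rewrite powR_inv1 // ltW.
  by rewrite powRrM powR_mulrn ?powR_ge0.
have [X hX] : exists X, X = mpow A (- 2^-1) *m B *m mpow A (- 2^-1) by eexists.
rewrite -hX in pX; rewrite -hX in qX; rewrite -hX.
rewrite -{1}(mpow_herm A (2^-1)) qform_congr hAv qformZv.
have h := jensen_le pX a01 v1.
rewrite qX in h.
have B0 : 0 <= qform B v by case/psdP: (pd_psd hB).
have -> : powR x (2^-1) ^+ 2 = x.
  by rewrite powR12_sqrt ?sqr_sqrtr // ltW.
apply: le_trans (ler_wpM2l (ltW x0) h) _.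
rewrite powRM ?invr_ge0 ?(ltW x0) // mulrA le_eqVlt; apply/orP; left; apply/eqP; congr (_ * _).
rewrite -(powR_inv1 (ltW x0)) -powRrM -{1}(powRr1 (ltW x0)) -powRD; last by rewrite (gt_eqF x0) implybT.
by rewrite mulN1r.
Qed.

End GeometricMeanBounds.

(** * Necessity of [1 <= p <= q] *)

Section TwoByTwo.
Variable R : realType.
Local Notation C := (R[i]).

Definition rmx2 (a b c d : R) : 'M[C]_2 :=
  \matrix_(i, j) ((if i == 0 then (if j == 0 then a else b) else (if j == 0 then c else d))%:C)%C.
Definition rcol2 (x y : R) : 'cV[C]_2 := \col_i ((if i == 0 then x else y)%:C)%C.

Lemma ord2_ind (P : 'I_2 -> Prop) : P 0 -> P 1 -> forall i, P i.
Proof.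
move=> p0 p1 [[|[|//]] hi]; [move: p0|move: p1]; congr P; exact: val_inj.
Qed.

Lemma rmx2_eq (A B : 'M[C]_2) : A 0 0 = B 0 0 -> A 0 1 = B 0 1 -> A 1 0 = B 1 0 -> A 1 1 = B 1 1 -> A = B.
Proof. by move=> *; apply/matrixP; elim/ord2_ind; elim/ord2_ind. Qed.

Lemma sum2 (V : nmodType) (F : 'I_2 -> V) : \sum_i F i = F 0 + F 1.
Proof. by rewrite !big_ord_recl big_ord0 addr0; congr (F _ + F _); exact: val_inj. Qed.

Lemma rmx2M a b c d a' b' c' d' : rmx2 a b c d *m rmx2 a' b' c' d' =
  rmx2 (a * a' + b * c') (a * b' + b * d') (c * a' + d * c') (c * b' + d * d').
Proof. by apply: rmx2_eq; rewrite !mxE sum2 !mxE /= -!rmorphM -rmorphD. Qed.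
Lemma rmx2_adj a b c d : (rmx2 a b c d)^t* = rmx2 a c b d.
Proof. by apply: rmx2_eq; rewrite !mxE /= conjCE conjc_real. Qed.
Lemma rmx2D a b c d a' b' c' d' : rmx2 a b c d + rmx2 a' b' c' d' =
  rmx2 (a + a') (b + b') (c + c') (d + d').
Proof. by apply: rmx2_eq; rewrite !mxE /= -rmorphD. Qed.
Lemma rmx2Z k a b c d : k%:C%C *: rmx2 a b c d = rmx2 (k * a) (k * b) (k * c) (k * d).
Proof. by apply: rmx2_eq; rewrite !mxE /= -rmorphM. Qed.
Lemma rmx2_1 : rmx2 1 0 0 1 = 1%:M.
Proof. by apply: rmx2_eq; rewrite !mxE. Qed.
Lemma rmx2_col a b c d x y : rmx2 a b c d *m rcol2 x y = rcol2 (a * x + b * y) (c * x + d * y).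
Proof.
apply/matrixP => i j; rewrite ord1; elim/ord2_ind: i;
by rewrite !mxE sum2 !mxE /= -!rmorphM -rmorphD.
Qed.
Lemma bform_rcol2 x y x' y' : bform 1%:M (rcol2 x y) (rcol2 x' y') = x * x' + y * y'.
Proof.
by rewrite /bform mulmx1 mxE sum2 !mxE /= !(oppr0, mulr0, mul0r, subr0).
Qed.
Lemma qform_rmx2 a b c d x y : qform (rmx2 a b c d) (rcol2 x y) =
  x * (a * x + b * y) + y * (c * x + d * y).
Proof. by rewrite /qform -[rmx2 _ _ _ _]mul1mx bformMr rmx2_col bform_rcol2. Qed.

(* The real symmetric matrix with eigenvalue [x] at [(cs, sn)] and [y] at [(-sn, cs)]. *)
Definition spec2 (cs sn x y : R) : 'M[C]_2 :=
  rmx2 (cs ^+ 2 * x + sn ^+ 2 * y) (cs * sn * (x - y)) (cs * sn * (x - y)) (sn ^+ 2 * x + cs ^+ 2 * y).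

Lemma rot_unitary cs sn : cs ^+ 2 + sn ^+ 2 = 1 -> rmx2 cs sn (- sn) cs \is unitarymx.
Proof.
move=> h; apply/unitarymxP; rewrite rmx2_adj rmx2M -rmx2_1.
by congr rmx2; rewrite -?h; ring.
Qed.

Lemma spec2_cdiag cs sn x y :
  spec2 cs sn x y = cdiag (rmx2 cs sn (- sn) cs) (fun i => if i == 0 then x else y).
Proof.
rewrite /cdiag.
have h : diag_mx (\row_i (((if i == 0 then x else y)%:C)%C : C)) = rmx2 x 0 0 y.
  by apply: rmx2_eq; rewrite !mxE.
have h2 : spec2 cs sn x y = (rmx2 cs sn (- sn) cs)^t* *m rmx2 x 0 0 y *m rmx2 cs sn (- sn) cs.
  by rewrite rmx2_adj !rmx2M /spec2; congr rmx2; ring.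
exact: etrans h2 (congr1 (fun Z => _ *m Z *m _) (esym h)).
Qed.

Lemma spec2_herm cs sn x y : hermmx (spec2 cs sn x y).
Proof. by rewrite spec2_cdiag; apply: cdiag_herm. Qed.

Lemma mpow_spec2 cs sn x y t : cs ^+ 2 + sn ^+ 2 = 1 ->
  mpow (spec2 cs sn x y) t = spec2 cs sn (powR x t) (powR y t).
Proof.
move=> h; rewrite mpow_fcm (fcm_unique _ (rot_unitary h) (spec2_cdiag _ _ _ _) (spec2_herm _ _ _ _)).
rewrite spec2_cdiag; congr cdiag; apply: funext => i.
by case: ifP.
Qed.

Lemma spec2_wt cs sn x y v : exists w0 w1, [/\ 0 <= w0, 0 <= w1,
  cs ^+ 2 + sn ^+ 2 = 1 -> qform 1%:M v = w0 + w1 & qform (spec2 cs sn x y) v = w0 * x + w1 * y].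
Proof.
exists (nrm2 ((rmx2 cs sn (- sn) cs *m v) 0 0)), (nrm2 ((rmx2 cs sn (- sn) cs *m v) 1 0)).
split; try exact: nrm2_ge0.
  move=> h; rewrite -(cdiag_cst 1 (rot_unitary h)) qform_cdiag sum2 !mulr1; by [].
by rewrite spec2_cdiag qform_cdiag sum2.
Qed.

Lemma spec2_pd cs sn x y : cs ^+ 2 + sn ^+ 2 = 1 -> 0 < x -> 0 < y -> pdmx (spec2 cs sn x y).
Proof.
move=> h x0 y0; apply/pdP; split; first exact: spec2_herm.
move=> v /qform1_gt0; have [w0 [w1 [p0 p1 /(_ h) -> ->]]] := spec2_wt cs sn x y v.
rewrite le_eqVlt in p0; case/orP: p0 => [/eqP <-|p0 _].
  by rewrite add0r mul0r add0r => ?; apply: mulr_gt0.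
by rewrite ltr_pwDl // ?mulr_gt0 // mulr_ge0 // ltW.
Qed.

Lemma spec2_le1 cs sn x y v : cs ^+ 2 + sn ^+ 2 = 1 -> x <= 1 -> y <= 1 ->
  qform (spec2 cs sn x y) v <= qform 1%:M v.
Proof.
move=> h x1 y1; have [w0 [w1 [p0 p1 /(_ h) -> ->]]] := spec2_wt cs sn x y v.
by apply: lerD; rewrite ler_piMr.
Qed.

(** Values of the form at unit vectors lie between the two eigenvalues: the larger eigenvalue
    satisfies the left alternative, the smaller one the right. This locates the spectrum from
    diagonal entries alone. *)
Lemma eigv2_dichotomy (H : 'M[C]_2) (u v : 'cV[C]_2) i : hermmx H ->
  qform 1%:M u = 1 -> qform 1%:M v = 1 -> qform H u <= eigv H i \/ eigv H i <= qform H v.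
Proof.
move=> hH; rewrite (qform1_wt H u) (qform1_wt H v) !(qform_wt _ hH) !sum2.
have := wt_ge0 H u 0; have := wt_ge0 H u 1; have := wt_ge0 H v 0; have := wt_ge0 H v 1.
have hi : eigv H i = eigv H 0 \/ eigv H i = eigv H 1 by elim/ord2_ind: i; [left|right].
move: (wt H u 0) (wt H u 1) (wt H v 0) (wt H v 1) => a b c d d0 c0 b0 a0 ab cd.
move: (eigv H 0) (eigv H 1) (eigv H i) hi => x y z hi.
have [xy|yx] := leP x y.
  case: hi => ->; [right|left].
    apply: (@le_trans _ _ (c * x + d * x)); first by rewrite -mulrDl cd mul1r.
    by rewrite lerD2l ler_wpM2l.
  apply: (@le_trans _ _ (a * y + b * y)); last by rewrite -mulrDl ab mul1r.
  by rewrite lerD2r ler_wpM2l.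
move/ltW: yx => yx; case: hi => ->; [left|right].
  apply: (@le_trans _ _ (a * x + b * x)); last by rewrite -mulrDl ab mul1r.
  by rewrite lerD2l ler_wpM2l.
apply: (@le_trans _ _ (c * y + d * y)); first by rewrite -mulrDl cd mul1r.
by rewrite lerD2r ler_wpM2l.
Qed.

End TwoByTwo.

(** * Spectral estimates for roots and resolvents *)

Section Necessity.
Variable R : realType.
Local Notation C := (R[i]).
Local Notation e1 := (rcol2 (1 : R) 0).
Local Notation e2 := (rcol2 (0 : R) 1).

Lemma unit_e1 : qform 1%:M e1 = 1.
Proof. by rewrite /qform bform_rcol2; ring. Qed.
Lemma unit_e2 : qform 1%:M e2 = 1.
Proof. by rewrite /qform bform_rcol2; ring. Qed.
Lemma qform_e1 a b c d : qform (rmx2 a b c d) e1 = a.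
Proof. by rewrite qform_rmx2; ring. Qed.
Lemma qform_e2 a b c d : qform (rmx2 a b c d) e2 = d.
Proof. by rewrite qform_rmx2; ring. Qed.

Lemma qform_fcm_affine n (A : 'M[C]_n) s t v : hermmx A ->
  qform (fcm (fun x => s * x - t) A) v = s * qform A v - t * qform 1%:M v.
Proof.
move=> hA; rewrite qform_fcm (qform_wt _ hA) (qform1_wt A) !mulr_sumr -sumrB.
by apply: eq_bigr => i _; ring.
Qed.

Lemma Gmean_le_qform n (A B : 'M[C]_n) a p q : pdmx A -> pdmx B ->
  loewner_le (Gmean a p A B) (Amean a q A B) -> forall v,
  qform (mpow (wgm_pd (mpow A p) (mpow B p) a) (p^-1)) v <=
  qform (mpow ((1 - a)%:C%C *: mpow A q + a%:C%C *: mpow B q) (q^-1)) v.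
Proof.
move=> hA hB; rewrite /Gmean /Amean !mpowE /wgm.
case: asboolP => [_|]; last by case; split; exact: mpow_pd.
by move/loewnerP; apply; exact: mpow_herm.
Qed.

(* As [p <= 1], [x^(1/p) >= l^(1/p - 1) (x - eta)] on the spectrum of [N]: an
   eigenvalue is either at least [N_11 >= l] or at most [N_22 <= eta]. *)
Lemma mpow_root_lower (N : 'M[C]_2) p l eta : pdmx N -> 0 < p <= 1 -> 0 < l ->
  (forall z, l * bform 1%:M e1 z ^+ 2 <= qform N z) -> qform N e2 <= eta ->
  forall z, powR l (p^-1) * bform 1%:M e1 z ^+ 2 - powR l (p^-1 - 1) * eta * qform 1%:M z <=
    qform (mpow N (p^-1)) z.
Proof.
move=> hN /andP[p0 p1] l0 hl heta z.
have hN11 : l <= qform N e1 by have := hl e1; rewrite -/(qform _ e1) unit_e1 expr1n mulr1.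
have r0 : 0 <= p^-1 - 1 by rewrite subr_ge0 invf_ge1.
have lp : 0 <= powR l (p^-1 - 1) by exact: powR_ge0.
have e0 : 0 <= eta by apply: le_trans heta; case/psdP: (pd_psd hN).
apply: (@le_trans _ _ (qform (fcm (fun x => powR l (p^-1 - 1) * x - powR l (p^-1 - 1) * eta) N) z)).
  rewrite qform_fcm_affine; last exact/psd_herm/pd_psd.
  rewrite lerD2r.
  have -> : powR l (p^-1) = powR l (p^-1 - 1) * l.
    by rewrite mulrC mulr_powRB1 ?invr_gt0 // ltW.
  by rewrite -mulrA ler_wpM2l.
rewrite mpow_fcm; apply: fcm_le => i.
have x0 := pd_eigv i hN.
rewrite -mulrBr.
have [h|h] := eigv2_dichotomy i (psd_herm (pd_psd hN)) unit_e1 unit_e2.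
  have lx := le_trans hN11 h.
  apply: (@le_trans _ _ (powR (eigv N i) (p^-1 - 1) * eigv N i)); last first.
    by rewrite mulrC mulr_powRB1 ?invr_gt0 // ltW.
  apply: (@le_trans _ _ (powR l (p^-1 - 1) * eigv N i)).
    by rewrite ler_wpM2l // gerBl.
  rewrite ler_wpM2r ?(ltW x0) // ge0_ler_powR // nnegrE ?(ltW x0) ?(ltW l0) //.
apply: (@le_trans _ _ 0); last exact: powR_ge0.
by rewrite mulr_ge0_le0 // subr_le0 (le_trans h heta).
Qed.

(* Take [z = (M^(1/q) + eta)^-1 e]. *)
Lemma resolvent_bound n (M : 'M[C]_n) e q eta L : pdmx M -> 0 < eta -> qform 1%:M e = 1 ->
  (forall z, L * bform 1%:M e z ^+ 2 <= qform (mpow M (q^-1)) z + eta * qform 1%:M z) ->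
  L * qform (fcm (fun x => (powR x (q^-1) + eta)^-1) M) e <= 1.
Proof.
move=> hM eta0 e1 h.
pose f x : R := (powR x (q^-1) + eta)^-1.
have f0 x : 0 < f x by rewrite invr_gt0 ltr_wpDl ?powR_ge0.
rewrite -/f; have s0 := qform_gt0 (fcm_pd (fun i => f0 (eigv M i))) (unit_neq0 e1).
have := h (fcm f M *m e).
have -> : bform 1%:M e (fcm f M *m e) = qform (fcm f M) e by rewrite -bformMr mul1mx.
have -> : qform (mpow M (q^-1)) (fcm f M *m e) + eta * qform 1%:M (fcm f M *m e) = qform (fcm f M) e.
  pose g x : R := powR x (q^-1) + eta.
  have -> : qform (mpow M (q^-1)) (fcm f M *m e) + eta * qform 1%:M (fcm f M *m e) =
      qform (fcm g M) (fcm f M *m e).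
    by rewrite -qform_scalar -qformD -(fcm_cst eta M) mpow_fcm /fcm cdiagD.
  transitivity (qform ((fcm f M)^t* *m fcm g M *m fcm f M) e); first by rewrite qform_congr.
  rewrite (fcm_herm f M) fcm_mul fcm_mul; congr (qform _ e).
  by apply: eq_fcm => i; rewrite /f /g mulVf ?mul1r // gt_eqF // ltr_wpDl ?powR_ge0.
move: (qform _ e) s0 => s s0.
by rewrite expr2 mulrA -[leRHS]mul1r ler_pM2r.
Qed.

Lemma eigv_le1 n (M : 'M[C]_n) i : hermmx M -> (forall v, qform M v <= qform 1%:M v) -> eigv M i <= 1.
Proof.
move=> hM /(_ (eigvec M i)); rewrite qform_eigvec //.
by rewrite -[leRHS]mul1r ler_pM2r // qform1_gt0 // eigvec_neq0.
Qed.

(* On the spectrum of [M], [(1 + eta) / (x^(1/q) + eta)] dominates the quadratic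
   [1 + K (1 - x) (m11 - x)], whose value at [M] has (1,1) entry [1 + K m12^2]. *)
Lemma resolvent_lower m11 m12 m22 m q eta : let M := rmx2 m11 m12 m12 m22 in
  pdmx M -> (forall v, qform M v <= qform 1%:M v) -> 0 < q -> 0 < eta -> m22 <= m -> 0 < m <= 1 ->
  1 + ((1 + eta) / (powR m (q^-1) + eta) - 1) * m12 ^+ 2 <=
  (1 + eta) * qform (fcm (fun x => (powR x (q^-1) + eta)^-1) M) e1.
Proof.
move=> M hM hM1 q0 eta0 hm /andP[m0 m1].
have q0' : 0 <= q^-1 by rewrite invr_ge0 ltW.
have hH : hermmx M by exact/psd_herm/pd_psd.
have hden x : 0 < powR x (q^-1) + eta by rewrite ltr_wpDl ?powR_ge0.
have le1 x : 0 < x -> x <= 1 -> powR x (q^-1) <= 1.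
  move=> x0 x1; apply: (@le_trans _ _ (powR 1 (q^-1))); last by rewrite powR1.
  by rewrite ge0_ler_powR // nnegrE ltW.
have ge1 x : 0 < x -> x <= 1 -> 1 <= (1 + eta) / (powR x (q^-1) + eta).
  by move=> x0 x1; rewrite ler_pdivlMr // mul1r lerD2r le1.
have [K hK] : exists K, K = (1 + eta) / (powR m (q^-1) + eta) - 1 by eexists.
have K0 : 0 <= K by rewrite hK subr_ge0 ge1.
rewrite -hK.
have -> : 1 + K * m12 ^+ 2 = qform (fcm (fun x => 1 + K * ((1 - x) * (m11 - x))) M) e1.
  have s1 : \sum_i wt M e1 i = 1 by rewrite -qform1_wt unit_e1.
  have s2 : \sum_i wt M e1 i * eigv M i = m11 by rewrite -(qform_wt _ hH) qform_e1.
  have s3 : \sum_i wt M e1 i * (eigv M i * eigv M i) = m11 ^+ 2 + m12 ^+ 2.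
    rewrite -(qform_fcm (fun x => x * x)) -fcm_mul fcm_id // rmx2M qform_e1; ring.
  rewrite qform_fcm.
  transitivity ((1 + K * m11) * (\sum_i wt M e1 i) - K * (1 + m11) * (\sum_i wt M e1 i * eigv M i)
     + K * (\sum_i wt M e1 i * (eigv M i * eigv M i))).
    by rewrite s1 s2 s3; ring.
  rewrite !mulr_sumr -sumrB -big_split /=; apply: eq_bigr => i _; ring.
have -> : (1 + eta) * qform (fcm (fun x => (powR x (q^-1) + eta)^-1) M) e1 =
    qform (fcm (fun x => (1 + eta) / (powR x (q^-1) + eta)) M) e1.
  by rewrite !qform_fcm mulr_sumr; apply: eq_bigr => i _; ring.
apply: fcm_le => i.
have x0 := pd_eigv i hM; have x1 := eigv_le1 i hH hM1.
have m11le : m11 <= 1 by have := hM1 e1; rewrite qform_e1 unit_e1.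
have := eigv2_dichotomy i hH unit_e1 unit_e2; rewrite qform_e1 qform_e2.
move: (eigv M i) x0 x1 => x x0 x1 hx.
(* Between [m11] and 1 the quadratic is at most 1. Below [m11] it is at most [1 + K], and the
   dichotomy gives [x <= m]; [K] is chosen so that [1 + K] is the value of the fraction at [m]. *)
have [h|h] := leP m11 x.
  apply: le_trans (ge1 _ x0 x1); rewrite gerDl mulr_ge0_le0 //.
  by rewrite mulr_ge0_le0 // ?subr_ge0 // subr_le0.
have {}hx : x <= m by case: hx => hx; [move: (lt_le_trans h hx); rewrite ltxx|exact: le_trans hx hm].
apply: (@le_trans _ _ (1 + K)).
  rewrite lerD2l ler_piMr //; apply: mulr_ile1; rewrite ?subr_ge0 ?(ltW h) //; [lra|].
  by clear -m11le x0; lra.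
rewrite hK addrC subrK ler_pM2l ?lef_pV2 ?posrE // ?lerD2r; last by rewrite ltr_wpDl.
by rewrite ge0_ler_powR // nnegrE ltW.
Qed.

End Necessity.

(** * The two tests *)

Section NecessaryInequalities.
Variable R : realType.
Local Notation C := (R[i]).
Local Notation e1 := (rcol2 (1 : R) 0).
Local Notation e2 := (rcol2 (0 : R) 1).

Lemma powR_le1 (x r : R) : 0 <= x <= 1 -> 0 <= r -> powR x r <= 1.
Proof.
move=> /andP[x0 x1] r0; have := ge0_ler_powR r0 x0 (@ler01 R) x1.
by rewrite powR1.
Qed.

Lemma powR_ge1 (x r : R) : 1 <= x -> 0 <= r -> 1 <= powR x r.
Proof.
move=> x1 r0; have := ge0_ler_powR r0 (@ler01 R) (le_trans ler01 x1) x1.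
by rewrite powR1.
Qed.

Lemma unit_circle (T : R) : 0 <= T <= 1 -> Num.sqrt (1 - T) ^+ 2 + Num.sqrt T ^+ 2 = 1.
Proof. by move=> /andP[T0 T1]; rewrite !sqr_sqrtr ?subr_ge0 // subrK. Qed.

Lemma diag_circle : 1 ^+ 2 + 0 ^+ 2 = 1 :> R.
Proof. by rewrite expr1n expr0n addr0. Qed.

Lemma mpow_diag_e1 (x t : R) : mpow (spec2 1 0 1 x) t *m e1 = e1.
Proof.
rewrite mpow_spec2; last exact: diag_circle.
by rewrite powR1 /spec2 rmx2_col; congr rcol2; ring.
Qed.

Lemma mpow_diag_e2 (x t : R) : mpow (spec2 1 0 1 x) t *m e2 = ((powR x t)%:C%C) *: e2.
Proof.
rewrite mpow_spec2; last exact: diag_circle.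
rewrite powR1 /spec2 rmx2_col.
have h : rcol2 ((1 ^+ 2 * 1 + 0 ^+ 2 * powR x t) * 0 + 1 * 0 * (1 - powR x t) * 1)
  (1 * 0 * (1 - powR x t) * 0 + (0 ^+ 2 * 1 + 1 ^+ 2 * powR x t) * 1) = rcol2 0 (powR x t).
  by congr rcol2; ring.
rewrite h; apply/matrixP => i j; rewrite ord1; elim/ord2_ind: i; rewrite !mxE /= ?mulr0 //.
by rewrite -rmorphM mulr1.
Qed.

(** Here [A = diag(1, eps)]. With [c = (B^-p)_11 = 1 - T + T d^-p], the mean [N] of the [p]-th
    powers dominates [c^-a] times the projection on [e1] and has [N_22 <= eta], so [N^(1/p)]
    dominates [c^(-a/p)] times that projection up to [eta]. The hypothesis then bounds the (1,1)
    entry of [(M^(1/q) + eta)^-1] by [c^(a/p)], and [resolvent_lower] bounds it from below through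
    [M_12^2]. *)
Lemma mean_test_near_projection (a p q d eps T eta m : R) :
  0 < a < 1 -> 0 < p <= 1 -> 0 < q -> 0 < d <= 1 -> 0 < eps <= 1 -> 0 <= T <= 1 ->
  powR eps (p * (1 - a)) <= eta ->
  a * (T + (1 - T) * powR d q) + (1 - a) * powR eps q <= m -> 0 < m <= 1 ->
  (forall A B : 'M[C]_2, pdmx A -> pdmx B -> loewner_le (Gmean a p A B) (Amean a q A B)) ->
  1 + ((1 + eta) / (powR m (q^-1) + eta) - 1) * (a ^+ 2 * (T * (1 - T)) * (1 - powR d q) ^+ 2) <=
  (1 + eta) * powR (1 - T + T * powR d (- p)) (a / p).
Proof.
move=> /andP[a0 a1] /andP[p0 p1] q0 /andP[d0 d1] /andP[eps0 eps1] hT heta hm m01 cond.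
have a01 : 0 <= a <= 1 by rewrite (ltW a0) ltW.
have [T0 T1] := andP hT.
have hc := unit_circle hT.
have [cs hcs] : exists cs, cs = Num.sqrt (1 - T) by eexists.
have [sn hsn] : exists sn, sn = Num.sqrt T by eexists.
have hcs2 : cs ^+ 2 = 1 - T by rewrite hcs sqr_sqrtr // subr_ge0.
have hsn2 : sn ^+ 2 = T by rewrite hsn sqr_sqrtr.
rewrite -hcs -hsn in hc.
have hA : pdmx (spec2 1 0 1 eps) by apply: spec2_pd => //; exact: diag_circle.
have hB : pdmx (spec2 cs sn 1 d) by apply: spec2_pd.
have hle := Gmean_le_qform hA hB (cond _ _ hA hB).
have hAp := mpow_pd p hA; have hBp := mpow_pd p hB.
have [N hN] : exists N, N = wgm_pd (mpow (spec2 1 0 1 eps) p) (mpow (spec2 cs sn 1 d) p) a by eexists.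
have [M hM] : exists M, M = (1 - a)%:C%C *: mpow (spec2 1 0 1 eps) q + a%:C%C *: mpow (spec2 cs sn 1 d) q by eexists.
rewrite -hN -hM in hle.
have pN : pdmx N by rewrite hN; apply: wgm_pd_pd.
have [c ec] : exists c, c = 1 - T + T * powR d (- p) by eexists.
have c1 : 1 <= c.
  have : 1 <= powR d (- p) by rewrite powRN invf_ge1 ?powR_gt0 // powR_le1 ?(ltW d0) ?(ltW p0).
  by rewrite ec => h; have := ler_wpM2l T0 h; clear; lra.
have c0 : 0 < c by exact: lt_le_trans c1.
have hAe t : mpow (mpow (spec2 1 0 1 eps) p) t *m e1 = e1 by rewrite mpowM mpow_diag_e1.
have lowN z : (powR c a)^-1 * bform 1%:M e1 z ^+ 2 <= qform N z.
  have := wgm_pd_lower z a01 hAp hBp hAe (unit_e1 R).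
  rewrite mpowM mpow_spec2 // powR1 qform_e1 hcs2 hsn2 mulr1 mulrN1 -ec -hN => h.
  by rewrite mulrC ler_pdivrMr ?powR_gt0 // mulrC.
have upN : qform N e2 <= eta.
  have x0 : 0 < powR eps p by exact: powR_gt0.
  have hAv t : mpow (mpow (spec2 1 0 1 eps) p) t *m e2 = ((powR (powR eps p) t)%:C%C) *: e2.
    by rewrite mpowM mpow_diag_e2 powRrM.
  have := wgm_pd_upper a01 hAp hBp x0 hAv (unit_e2 R).
  rewrite -hN -powRrM => h; apply: le_trans h _; apply: le_trans heta.
  rewrite ler_piMr ?powR_ge0 //; apply: powR_le1 (ltW a0).
  apply/andP; split; first by case/psdP: (pd_psd hBp).
  rewrite mpow_spec2 // -[X in _ <= X](unit_e2 R); apply: spec2_le1 => //; first by rewrite powR1.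
  by rewrite powR_le1 ?(ltW d0) ?(ltW p0).
have eta0 : 0 < eta by apply: lt_le_trans heta; exact: powR_gt0.
have rootN := mpow_root_lower pN (_ : 0 < p <= 1) (_ : 0 < (powR c a)^-1) lowN upN.
have {rootN} rootN z := rootN (introT andP (conj p0 p1)) _ z.
have l0 : 0 < (powR c a)^-1 by rewrite invr_gt0 powR_gt0.
(* As [c >= 1] and [p <= 1], the factor of [eta] in [mpow_root_lower] is at most 1. *)
have l1 : powR (powR c a)^-1 (p^-1 - 1) <= 1.
  apply: powR_le1; last by rewrite subr_ge0 invf_ge1.
  by rewrite (ltW l0) invf_le1 ?powR_gt0 // powR_ge1 // ltW.
have eM : M = rmx2 ((1 - a) + a * (1 - T + T * powR d q)) (a * (cs * sn * (1 - powR d q)))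
   (a * (cs * sn * (1 - powR d q))) ((1 - a) * powR eps q + a * (T + (1 - T) * powR d q)).
  rewrite hM !mpow_spec2 //; last exact: diag_circle.
  by rewrite /spec2 !rmx2Z rmx2D !powR1 hcs2 hsn2; congr rmx2; ring.
have pM : pdmx M.
  have hAq := mpow_pd q hA; have hBq := mpow_pd q hB.
  rewrite hM; apply/pdP; split; first by apply: hermD; apply: hermZ; exact: mpow_herm.
  move=> v v0; rewrite qformD !qformZ ltr_wpDl //; last by rewrite mulr_gt0 // qform_gt0.
  by rewrite mulr_ge0 ?subr_ge0 ?(ltW a1) // ltW // qform_gt0.
have M1 v : qform M v <= qform 1%:M v.
  have le1 x : 0 < x <= 1 -> powR x q <= 1.
    by move=> /andP[x0 x1]; rewrite powR_le1 ?(ltW x0) ?(ltW q0).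
  rewrite hM qformD !qformZ !mpow_spec2 //; last exact: diag_circle.
  have h1 : qform (spec2 1 0 (powR 1 q) (powR eps q)) v <= qform 1%:M v.
    by apply: spec2_le1; rewrite ?diag_circle ?powR1 ?le1 ?eps0.
  have h2 : qform (spec2 cs sn (powR 1 q) (powR d q)) v <= qform 1%:M v.
    by apply: spec2_le1; rewrite ?powR1 ?le1 ?d0.
  have a1' : 0 <= 1 - a by rewrite subr_ge0 ltW.
  apply: le_trans (lerD (ler_wpM2l a1' h1) (ler_wpM2l (ltW a0) h2)) _.
  rewrite -mulrDl subrK mul1r; exact: lexx.
have [S hS] : exists S, S = qform (fcm (fun x => (powR x (q^-1) + eta)^-1) M) e1 by eexists.
have hup : powR (powR c a)^-1 (p^-1) * S <= 1.
  rewrite hS; apply: (resolvent_bound pM eta0 (unit_e1 R)) => z.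
  apply: le_trans (lerD (hle z) (lexx _)).
  rewrite -lerBlDr; apply: le_trans (rootN l0 z); rewrite lerD2l lerN2.
  rewrite ler_wpM2r ?ler_piMl ?(ltW eta0) //.
  by case/psdP: (pd_psd (mpow_pd 0 hA)) => _ /(_ z); rewrite mpow0.
have hlo : 1 + ((1 + eta) / (powR m (q^-1) + eta) - 1) * (a * (cs * sn * (1 - powR d q))) ^+ 2 <= (1 + eta) * S.
  rewrite hS eM; apply: (@resolvent_lower _ _ _ _ m q eta); rewrite -?eM // addrC //.
have e12 : (a * (cs * sn * (1 - powR d q))) ^+ 2 = a ^+ 2 * (T * (1 - T)) * (1 - powR d q) ^+ 2.
  by rewrite -hcs2 -hsn2; ring.
rewrite -e12 -ec; apply: le_trans hlo _; rewrite ler_pM2l ?addr_gt0 //.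
have cp : 0 < powR c (a / p) by exact: powR_gt0.
have ecp : powR (powR c a)^-1 (p^-1) = (powR c (a / p))^-1.
  by rewrite -powRN -powRrM -powRN mulNr.
by move: hup; rewrite ecp mulrC ler_pdivrMr // mul1r.
Qed.

(** Here [A = diag(1, H)], and the (1,1) entries of the inverse means are compared. For the
    geometric one, [N^-1] has the entry of [X^-a], where [X = A^(-p/2) B^p A^(-p/2)]. An eigenvalue
    [x] of [X] is at least [c = X_11], so that [x^-a <= c^-a], or it is at most [X_22 <= (d/H)^p],
    so that [x^-a <= w x^-1]. As [(X^-1)_11 <= 1], the entry is at most [c^-a + w]. Jensen passes to
    the exponents [1/p] and [-1/q]. *)
Lemma mean_test_large_spectrum (a p q d T w : R) :
  0 < a < 1 -> 1 <= p -> 0 < q -> 1 <= d -> 0 <= T <= 1 -> 0 < w ->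
  (forall A B : 'M[C]_2, pdmx A -> pdmx B -> loewner_le (Gmean a p A B) (Amean a q A B)) ->
  powR (1 + a * T * (powR d q - 1)) (- (p / q)) <= powR (1 + T * (powR d p - 1)) (- a) + w.
Proof.
move=> /andP[a0 a1] p1 q0 d1 hT w0 cond.
have a01 : 0 <= a <= 1 by rewrite (ltW a0) ltW.
have p0 : 0 < p by exact: lt_le_trans p1.
have d0 : 0 < d by exact: lt_le_trans d1.
have a1' : 0 < 1 - a by rewrite subr_gt0.
have [T0 T1] := andP hT.
have hc := unit_circle hT.
have [cs hcs] : exists cs, cs = Num.sqrt (1 - T) by eexists.
have [sn hsn] : exists sn, sn = Num.sqrt T by eexists.
have hcs2 : cs ^+ 2 = 1 - T by rewrite hcs sqr_sqrtr // subr_ge0.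
have hsn2 : sn ^+ 2 = T by rewrite hsn sqr_sqrtr.
rewrite -hcs -hsn in hc.
(* Chosen so that [(d/H)^(p (1 - a)) = w], see [hw]. *)
pose e := (p * (1 - a))^-1.
have [H hH] : exists H, H = d * powR w (- e) by eexists.
have H0 : 0 < H by rewrite hH mulr_gt0 ?powR_gt0.
have hA : pdmx (spec2 1 0 1 H) by apply: spec2_pd => //; exact: diag_circle.
have hB : pdmx (spec2 cs sn 1 d) by apply: spec2_pd.
have hle := Gmean_le_qform hA hB (cond _ _ hA hB).
have hAp := mpow_pd p hA; have hBp := mpow_pd p hB.
have hAq := mpow_pd q hA; have hBq := mpow_pd q hB.
have [M hM] : exists M, M = (1 - a)%:C%C *: mpow (spec2 1 0 1 H) q + a%:C%C *: mpow (spec2 cs sn 1 d) q by eexists.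
have pM : pdmx M.
  rewrite hM; apply/pdP; split; first by apply: hermD; apply: hermZ; exact: mpow_herm.
  move=> v v0; rewrite qformD !qformZ ltr_wpDl //; last by rewrite mulr_gt0 // qform_gt0.
  by rewrite mulr_ge0 ?subr_ge0 ?(ltW a1) // ltW // qform_gt0.
have pN := wgm_pd_pd a hAp hBp.
have eN := wgm_pd_inv a hAp hBp.
have [pX eX] := mpow_congr_inv (mpow_herm (mpow (spec2 1 0 1 H) p) (- 2^-1)) (mpowKN _ hAp) (mpowNK _ hAp) hBp.
have [N hN] : exists N, N = wgm_pd (mpow (spec2 1 0 1 H) p) (mpow (spec2 cs sn 1 d) p) a by eexists.
rewrite -hN -hM in hle; rewrite -hN in pN; rewrite -hN in eN.
have hAe t : mpow (mpow (spec2 1 0 1 H) p) t *m e1 = e1 by rewrite mpowM mpow_diag_e1.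
have hAv t : mpow (mpow (spec2 1 0 1 H) p) t *m e2 = ((powR H (p * t))%:C%C) *: e2.
  by rewrite mpowM mpow_diag_e2.
have hS := mpow_herm (mpow (spec2 1 0 1 H) p).
have qX1 : qform (mpow (mpow (spec2 1 0 1 H) p) (- 2^-1) *m mpow (spec2 cs sn 1 d) p *m
     mpow (mpow (spec2 1 0 1 H) p) (- 2^-1)) e1 = 1 - T + T * powR d p.
  rewrite -{1}(hS (- 2^-1)) qform_congr hAe mpow_spec2 // qform_e1 powR1 hcs2 hsn2; ring.
have qX2 : qform (mpow (mpow (spec2 1 0 1 H) p) (- 2^-1) *m mpow (spec2 cs sn 1 d) p *m
     mpow (mpow (spec2 1 0 1 H) p) (- 2^-1)) e2 <= powR (d / H) p.
  rewrite -{1}(hS (- 2^-1)) qform_congr hAv qformZv mpow_spec2 // qform_e2 powR1 hcs2 hsn2.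
  have -> : powR H (p * - 2^-1) ^+ 2 = (powR H p)^-1.
    rewrite expr2 -powRD ?(gt_eqF H0) ?implybT // -powRN.
    have -> : p * - 2^-1 + p * - 2^-1 = - p by field.
    by [].
  rewrite powRM ?invr_ge0 ?(ltW H0) ?(ltW d0) // -(powR_inv1 (ltW H0)) -powRrM mulN1r powRN mulrC.
  rewrite ler_pM2r ?invr_gt0 ?powR_gt0 // mulr1.
  have h := powR_ge1 d1 (ltW p0).
  have := ler_wpM2l T0 h; clear; lra.
have qX3 : qform (mpow (mpow (mpow (spec2 1 0 1 H) p) (- 2^-1) *m mpow (spec2 cs sn 1 d) p *m
     mpow (mpow (spec2 1 0 1 H) p) (- 2^-1)) (- 1)) e1 <= 1.
  rewrite eX -{1}(hS (2^-1)) qform_congr hAe mpowM mpow_spec2 // qform_e1 powR1 hcs2 hsn2 mulrN1.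
  have h : powR d (- p) <= 1 by rewrite powRN invf_le1 ?powR_gt0 // powR_ge1 // ltW.
  have := ler_wpM2l T0 h; clear; lra.
have [X hX] : exists X, X = mpow (mpow (spec2 1 0 1 H) p) (- 2^-1) *m mpow (spec2 cs sn 1 d) p *m
     mpow (mpow (spec2 1 0 1 H) p) (- 2^-1) by eexists.
rewrite -hX in pX; rewrite -hX in qX1; rewrite -hX in qX2; rewrite -hX in qX3; rewrite -hX in eN.
have [c hc'] : exists c, c = 1 - T + T * powR d p by eexists.
have c0 : 0 < c by rewrite hc' -qX1; apply: qform_gt0 (unit_neq0 (unit_e1 R)).
have hw : powR (powR (d / H) p) (1 - a) = w.
  have -> : d / H = powR w e.
    by rewrite hH invfM mulrA divff ?gt_eqF // mul1r powRN invrK.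
  by rewrite -!powRrM /e -?mulrA mulVf ?powRr1 ?(ltW w0) // gt_eqF // mulr_gt0.
have boundX : qform (mpow X (- a)) e1 <= powR c (- a) + w.
  apply: (@le_trans _ _ (qform (fcm (fun x => powR c (- a) + w * powR x (- 1)) X) e1)).
    rewrite mpow_fcm; apply: fcm_le => i.
    have x0 := pd_eigv i pX.
    have := eigv2_dichotomy i (psd_herm (pd_psd pX)) (unit_e1 R) (unit_e2 R).
    rewrite qX1 -hc'; case=> h.
      rewrite (@le_trans _ _ (powR c (- a))) ?lerDl ?mulr_ge0 ?powR_ge0 ?(ltW w0) //.
      rewrite !powRN lef_pV2 ?posrE ?powR_gt0 //.
      by rewrite ge0_ler_powR ?nnegrE ?(ltW a0) // ltW.
    rewrite (@le_trans _ _ (w * powR (eigv X i) (- 1))) ?lerDr ?powR_ge0 //.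
    have -> : powR (eigv X i) (- a) = powR (eigv X i) (1 - a) * powR (eigv X i) (- 1).
      by rewrite -powRD ?(gt_eqF x0) ?implybT //; congr powR; ring.
    rewrite ler_wpM2r ?powR_ge0 // -hw ge0_ler_powR ?nnegrE ?powR_ge0 ?(ltW a1') ?(ltW x0) //.
    exact: le_trans h qX2.
  have -> : qform (fcm (fun x => powR c (- a) + w * powR x (- 1)) X) e1 =
      powR c (- a) + w * qform (mpow X (- 1)) e1.
    have s1 : \sum_i wt X e1 i = 1 by rewrite -qform1_wt unit_e1.
    rewrite mpow_fcm !qform_fcm.
    transitivity (powR c (- a) * (\sum_i wt X e1 i) + w * \sum_i wt X e1 i * powR (eigv X i) (- 1)).
      rewrite !mulr_sumr -big_split /=; apply: eq_bigr => i _.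
      move: (powR _ (- a)) (powR _ (- 1)) => x y; ring.
    by rewrite s1 mulr1.
  by rewrite lerD2l -[leRHS]mulr1 ler_pM2l.
have h1 := inverse_antitone e1 (mpow_pd (p^-1) pN) (mpow_pd (q^-1) pM) hle.
have h2 : qform (mpow (mpow N p^-1) (- 1)) e1 <= powR (powR c (- a) + w) (p^-1).
  have -> : mpow (mpow N p^-1) (- 1) = mpow (mpow N (- 1)) p^-1 by rewrite !mpowM mulrC.
  have pi : 0 <= p^-1 <= 1 by rewrite invr_ge0 (ltW p0) invf_le1.
  apply: le_trans (jensen_le (mpow_pd _ pN) pi (unit_e1 R)) _.
  have hq : qform (mpow N (- 1)) e1 <= powR c (- a) + w by rewrite eN -{1}(hS (- 2^-1)) qform_congr hAe.
  apply: (ge0_ler_powR _ _ _ hq); first by case/andP: pi.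
    exact/ltW/(qform_gt0 (mpow_pd _ pN))/unit_neq0/unit_e1.
  exact: addr_ge0 (powR_ge0 _ _) (ltW w0).
have M11 : qform M e1 = 1 + a * T * (powR d q - 1).
  rewrite hM qformD !qformZ !mpow_spec2 //; last exact: diag_circle.
  by rewrite !qform_e1 !powR1 hcs2 hsn2; ring.
have h3 : powR (1 + a * T * (powR d q - 1)) (- q^-1) <= powR (powR c (- a) + w) (p^-1).
  apply: le_trans (le_trans h1 h2).
  rewrite -M11 mpowM mulrN1; apply: jensen_ge pM _ (unit_e1 R).
  by rewrite oppr_le0 invr_ge0 ltW.
have := @ge0_ler_powR _ p (ltW p0) _ _ _ _ h3.
rewrite !nnegrE !powR_ge0 => /(_ isT isT).
rewrite -!powRrM mulVf ?gt_eqF // powRr1 ?addr_ge0 ?powR_ge0 ?(ltW w0) //.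
rewrite mulNr (mulrC _ p) => h; apply: le_trans h _.
by rewrite hc' (_ : 1 - T + T * powR d p = 1 + T * (powR d p - 1)) //; ring.
Qed.

End NecessaryInequalities.

(** * Choice of the parameters *)

Section Conclusion.
Variable R : realType.
Local Notation C := (R[i]).

Lemma exists_small_powR (r1 r2 b b1 b2 : R) : 0 < r1 -> 0 < r2 -> 0 < b -> 0 < b1 -> 0 < b2 ->
  exists d, [/\ 0 < d, d < b, powR d r1 < b1 & powR d r2 < b2].
Proof.
move=> r10 r20 b0 b10 b20.
apply: (@filter_ex _ ((0 : R)^'+)%classic _ (fun d => [/\ 0 < d, d < b, powR d r1 < b1 & powR d r2 < b2])).
near=> d; split; near: d.
- exact: nbhs_right_gt.
- exact: nbhs_right_lt.
- exact: (cvgr_lt 0 (powR_cvg0 r10)).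
- exact: (cvgr_lt 0 (powR_cvg0 r20)).
Unshelve. all: by end_near.
Qed.

Lemma powR_anti (x y r : R) : 0 < x -> x <= y -> 0 <= r -> powR y (- r) <= powR x (- r).
Proof.
move=> x0 xy r0; have y0 := lt_le_trans x0 xy.
by rewrite !powRN lef_pV2 ?posrE ?powR_gt0 // ge0_ler_powR // nnegrE ltW.
Qed.

(** The tangent bound for the exponent [-s] gives [(1 + u)^-s >= 1 - v] with [v = s u], and
    [1 / (1 - v) <= 1 + 2 v] for [0 <= v <= 1/2]. *)
Lemma powR1D_le (u s : R) : 0 <= u -> 0 <= s -> s * u <= 2^-1 -> powR (1 + u) s <= 1 + 2 * (s * u).
Proof.
move=> u0 s0 su.
have su0 : 0 <= s * u by exact: mulr_ge0.
have x0 : 0 < 1 + u by rewrite ltr_wpDr.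
have h : 1 - s * u <= powR (1 + u) (- s).
  have ns : - s <= 0 by rewrite oppr_le0.
  have := powR_ge_tangent_neg x0 ns.
  by rewrite addrAC subrr add0r mulNr.
have P0 := powR_gt0 s x0.
have : (1 - s * u) * powR (1 + u) s <= 1.
  by move: h; rewrite powRN -[leRHS]mul1r ler_pdivlMr // mul1r.
move: (powR _ s) P0 (s * u) su su0 => P P0 v hv v0 h1.
rewrite -(ler_pM2l (_ : 0 < 1 - v)); last by lra.
apply: le_trans h1 _; nra.
Qed.

Lemma exponent_ge1 (a p q : R) : 0 < a < 1 -> 0 < p -> 0 < q ->
  (forall A B : 'M[C]_2, pdmx A -> pdmx B -> loewner_le (Gmean a p A B) (Amean a q A B)) ->
  1 <= p.
Proof.
move=> a01 p0 q0 cond; rewrite leNgt; apply/negP => p1.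
have [a0 a1] := andP a01.
have a1' : 0 < 1 - a by rewrite subr_gt0.
pose s := a / p; have s0 : 0 < s by exact: divr_gt0.
(* With [m = 2 d^q] and [eta <= d], the denominator [m^(1/q) + eta] is at most [Cq d]. *)
have [Cq hCq] : exists Cq, Cq = powR 2 (q^-1) + 1 :> R by eexists.
have Cq1 : 1 <= Cq by rewrite hCq lerDr powR_ge0.
have Cq0 : 0 < Cq by exact: lt_le_trans Cq1.
have bb : 0 < Num.min (1 / 4) (1 / (2 * (s + 1))) :> R.
  by rewrite lt_min !divr_gt0 ?mulr_gt0 ?addr_gt0.
have p1' : 0 < 1 - p by rewrite subr_gt0.
have b0 : 0 < 1 / (2 * Cq) by rewrite divr_gt0 ?mulr_gt0.
have b2 : 0 < a ^+ 2 / (16 * Cq) / (2 * (s + 1)).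
  by rewrite !divr_gt0 ?mulr_gt0 ?addr_gt0 ?exprn_gt0.
(* [d < 1/(2 Cq)] lets half of [1/(Cq d)] absorb the [- 1] in [hK]; the bounds on [d^q] keep [T] and
   [m] in range and allow [powR1D_le] with exponent [s + 1]; the bound on [d^(1-p)], attainable
   since [p < 1], contradicts the final estimate. *)
have [d [d0 db]] := exists_small_powR q0 p1' b0 bb b2.
rewrite lt_min => /andP[u1 u2] d2.
have d1 : d < 1.
  apply: lt_le_trans db _; rewrite ler_pdivrMr ?mulr_gt0 // mul1r.
  by clear -Cq1; lra.
have dle x y : y <= x -> powR d x <= powR d y.
  by move=> xy; apply: (ger_powR _ xy); rewrite d0 ltW.
have [u hu] : exists u, u = powR d q by eexists.
have u0 : 0 < u by rewrite hu powR_gt0.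
rewrite -hu in u1 u2.
have dn0 : d != 0 by rewrite gt_eqF.
have dD x y : powR d (x + y) = powR d x * powR d y by rewrite powRD // dn0 implybT.
have [T hT] : exists T, T = powR d (p + q) by eexists.
have T0 : 0 < T by rewrite hT powR_gt0.
have Tu : T <= u by rewrite hT hu dle // lerDr ltW.
(* For [eps = d^e], the summand 1 gives [eps <= d], hence [eps^q <= u], and the fraction gives
   [eps^(p (1 - a)) <= d^(q+1) = eta]. In turn [eta] is at most both [d] and [u]. *)
pose e := 1 + (q + 1) / (p * (1 - a)).
have pa0 : 0 < p * (1 - a) by exact: mulr_gt0.
have e1 : 1 <= e by rewrite /e lerDl divr_ge0 ?addr_ge0 // ltW.
have [eta heta] : exists eta, eta = powR d (q + 1) by eexists.
have eta0 : 0 < eta by rewrite heta powR_gt0.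
have etad : eta <= d by rewrite heta -[leRHS](powRr1 (ltW d0)) dle // lerDr ltW.
have etau : eta <= u by rewrite heta hu dle // lerDl.
have d01 : 0 < d <= 1 by rewrite d0 ltW.
have eps01 : 0 < powR d e <= 1.
  by rewrite powR_gt0 //= powR_le1 ?(ltW d0) ?(ltW d1) // (le_trans ler01 e1).
have T01 : 0 <= T <= 1.
  by rewrite (ltW T0) /=; apply: le_trans Tu _; clear -u1; lra.
have c1 : powR (powR d e) (p * (1 - a)) <= eta.
  rewrite -powRrM heta dle // /e mulrDl mul1r divfK ?gt_eqF // lerDr ltW //.
have c2 : a * (T + (1 - T) * powR d q) + (1 - a) * powR (powR d e) q <= 2 * u.
  rewrite -powRrM -hu.
  have h1 : powR d (e * q) <= u by rewrite hu dle // ler_peMl // ltW.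
  have h2 : (1 - T) * u <= u by rewrite ler_piMl ?(ltW u0) // gerBl ltW.
  apply: (@le_trans _ _ (a * (u + u) + (1 - a) * u)).
    by rewrite lerD // ler_wpM2l ?(ltW a0) ?(ltW a1') // lerD.
  by clear -u0 a1; nra.
have m01 : 0 < 2 * u <= 1 by rewrite mulr_gt0 //=; clear -u1; lra.
have p01 : 0 < p <= 1 by rewrite p0 ltW.
have := mean_test_near_projection a01 p01 q0 d01 eps01 T01 c1 c2 m01 cond.
rewrite -hu.
have -> : T * powR d (- p) = u.
  rewrite hT hu -dD.
  have -> : p + q - p = q by ring.
  by [].
have em : powR (2 * u) (q^-1) = powR 2 (q^-1) * d.
  by rewrite powRM ?(ltW u0) // hu -powRrM mulfV ?gt_eqF // powRr1 // ltW.
rewrite em => main.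
have hK : 1 / (2 * Cq * d) <= (1 + eta) / (powR 2 q^-1 * d + eta) - 1.
  have den : powR 2 q^-1 * d + eta <= Cq * d by rewrite hCq mulrDl mul1r lerD2l.
  have den0 : 0 < powR 2 q^-1 * d + eta by rewrite ltr_wpDl // mulr_ge0 ?powR_ge0 // ltW.
  have h1 : 1 / (Cq * d) <= (1 + eta) / (powR 2 q^-1 * d + eta).
    rewrite ler_pM ?invr_ge0 ?lerDl ?(ltW eta0) //; first by rewrite mulr_ge0 ?ltW.
    by rewrite lef_pV2 ?posrE // mulr_gt0.
  have h2 : 1 <= 1 / (2 * Cq * d).
    rewrite ler_pdivlMr ?mulr_gt0 // mul1r -ler_pdivlMl ?mulr_gt0 // mulr1 -[leRHS]mul1r ltW //.
  apply: le_trans (lerB h1 (lexx 1)).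
  have -> : 1 / (Cq * d) = 1 / (2 * Cq * d) + 1 / (2 * Cq * d).
    by field; rewrite dn0 gt_eqF.
  rewrite -addrA lerDl subr_ge0. exact: h2.
(* A crude bound from [T <= u < 1/4]; with the factor 2 of [hK] it produces the constant 16. *)
have hE : a ^+ 2 * T / 8 <= a ^+ 2 * (T * (1 - T)) * (1 - u) ^+ 2.
  have h1 : 1 / 8 <= (1 - T) * (1 - u) ^+ 2.
    have x1 : 3 / 4 <= 1 - T by clear -Tu u1; lra.
    have x2 : 1 / 2 <= (1 - u) ^+ 2 by clear -u1 u0; nra.
    by clear -x1 x2; nra.
  have -> : a ^+ 2 * T / 8 = a ^+ 2 * T * (1 / 8) by ring.
  have -> : a ^+ 2 * (T * (1 - T)) * (1 - u) ^+ 2 = a ^+ 2 * T * ((1 - T) * (1 - u) ^+ 2) by ring.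
  by rewrite ler_wpM2l // mulr_ge0 ?sqr_ge0 // ltW.
have low : 1 + a ^+ 2 / (16 * Cq) * (T / d) <= 1 + ((1 + eta) / (powR 2 q^-1 * d + eta) - 1) *
   (a ^+ 2 * (T * (1 - T)) * (1 - u) ^+ 2).
  rewrite lerD2l.
  have -> : a ^+ 2 / (16 * Cq) * (T / d) = 1 / (2 * Cq * d) * (a ^+ 2 * T / 8).
    by field; rewrite dn0 gt_eqF.
  apply: ler_pM hK hE; first by rewrite divr_ge0 ?mulr_ge0 ?ltW.
  by apply: divr_ge0 => //; apply: mulr_ge0 (sqr_ge0 a) (ltW T0).
(* Both [1 + eta] and [1 - T + u] are at most [1 + u]. *)
have up : (1 + eta) * powR (1 - T + u) (a / p) <= 1 + 2 * ((s + 1) * u).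
  have u10 : 0 < 1 + u by rewrite addr_gt0.
  apply: (@le_trans _ _ (powR (1 + u) (s + 1))).
    rewrite powRD ?(gt_eqF u10) ?implybT // powRr1 ?(ltW u10) // mulrC -/s.
    rewrite ler_pM ?powR_ge0 ?addr_ge0 ?(ltW eta0) ?lerD2l //.
    rewrite ge0_ler_powR ?nnegrE ?(ltW s0) ?(ltW u10) //.
      by clear -T01 u0; lra.
    by clear -T0; lra.
  apply: powR1D_le; rewrite ?(ltW u0) ?addr_ge0 ?(ltW s0) //.
  move: u2; rewrite ltr_pdivlMr ?mulr_gt0 ?addr_gt0 // => /ltW.
  by move: (s + 1) => x; clear; lra.
have := le_trans low (le_trans main up); rewrite lerD2l.
have -> : T / d = u / powR d (1 - p).
  rewrite hT hu -(powR_inv1 (ltW d0)) -powRN -!dD.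
  have -> : q - (1 - p) = p + q - 1 by ring.
  by [].
have D0 : 0 < powR d (1 - p) by exact: powR_gt0.
rewrite mulrA ler_pdivrMr // => fin.
move: d2; rewrite ltr_pdivlMr ?mulr_gt0 ?addr_gt0 //.
have {fin} : u * (a ^+ 2 / (16 * Cq)) <= u * (powR d (1 - p) * (2 * (s + 1))).
  rewrite mulrC; apply: le_trans fin _.
  by rewrite le_eqVlt; apply/orP; left; apply/eqP; ring.
by rewrite ler_pM2l // leNgt => /negP.
Qed.

Lemma exponent_le (a p q : R) : 0 < a < 1 -> 1 <= p -> 0 < q ->
  (forall A B : 'M[C]_2, pdmx A -> pdmx B -> loewner_le (Gmean a p A B) (Amean a q A B)) ->
  p <= q.
Proof.
move=> a01 p1 q0 cond; rewrite leNgt; apply/negP => qp.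
have [a0 a1] := andP a01.
have p0 : 0 < p by exact: lt_le_trans p1.
(* With [T d^p = 1] and [T < 1/2], the base on the geometric side is [2 - T >= 3/2]. *)
have [k hk] : exists k, k = powR (3 / 2) (- a) :> R by eexists.
have k1 : k < 1.
  rewrite hk powRN invf_lt1 ?powR_gt0 ?divr_gt0 // -[ltLHS](_ : powR 1 a = 1); last by rewrite powR1.
  by apply: gt0_ltr_powR; rewrite ?nnegrE //; lra.
have r0 : 0 < p - q by rewrite subr_gt0.
have b2 : 0 < (1 - k) * (q / p) by rewrite mulr_gt0 ?divr_gt0 // subr_gt0.
have h2 : 0 < 2^-1 :> R by rewrite invr_gt0.
(* [g] is [1/d]. The last condition makes the tangent bound [1 - (p/q) g^(p-q)] exceed [k]; it can
   be met because [p > q]. *)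
have [g [g0 g1 gp gr]] := exists_small_powR p0 r0 (@ltr01 R) h2 b2.
pose T := powR g p.
have T0 : 0 < T by exact: powR_gt0.
have T01 : 0 <= T <= 1 by rewrite (ltW T0) /T; apply: le_trans (ltW gp) _; rewrite invf_le1 // ler1n.
have d1 : 1 <= g^-1 by rewrite invf_ge1 // ltW.
have gV x : powR g^-1 x = powR g (- x).
  by rewrite -powR_inv1 ?(ltW g0) // -powRrM mulN1r.
have gn0 : g != 0 by rewrite gt_eqF.
have gD x y : powR g (x + y) = powR g x * powR g y by rewrite powRD // gn0 implybT.
have e1 : T * powR g^-1 q = powR g (p - q) by rewrite gV /T -gD.
have e2 : T * powR g^-1 p = 1 by rewrite gV /T -gD subrr powRr0.
have h : powR (1 + a * T * (powR g^-1 q - 1)) (- (p / q)) <= powR (1 + T * (powR g^-1 p - 1)) (- a).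
  (* The slack [w] is arbitrary, as the large eigenvalue of [A] is free to depend on it. *)
  apply/ler_addgt0Pr => w w0; exact: mean_test_large_spectrum.
have lo : 1 - p / q * powR g (p - q) <= powR (1 + a * T * (powR g^-1 q - 1)) (- (p / q)).
  have x0 : 0 < 1 + powR g (p - q) by rewrite addr_gt0 ?powR_gt0.
  apply: (@le_trans _ _ (powR (1 + powR g (p - q)) (- (p / q)))).
    have ns : - (p / q) <= 0 by rewrite oppr_le0 divr_ge0 // ltW.
    have := powR_ge_tangent_neg x0 ns.
    by rewrite addrAC subrr add0r mulNr.
  have -> : a * T * (powR g^-1 q - 1) = a * powR g (p - q) - a * T by rewrite -e1; ring.
  have aT : a * T < 1.
    by apply: lt_le_trans (_ : T <= 1); [rewrite gtr_pMl|case/andP: T01].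
  have x1 := powR_gt0 (p - q) g0.
  apply: powR_anti; last by rewrite divr_ge0 // ltW.
    by have := mulr_gt0 a0 x1; clear -aT; lra.
  have : a * powR g (p - q) <= powR g (p - q) by rewrite ler_piMl ?(ltW x1) // ltW.
  by have := mulr_gt0 a0 T0; clear; lra.
have up : powR (1 + T * (powR g^-1 p - 1)) (- a) <= k.
  rewrite hk; apply: powR_anti (ltW a0); first by rewrite divr_gt0.
  by rewrite mulrBr e2 mulr1; move: gp; rewrite -/T; clear; lra.
have := le_trans lo (le_trans h up).
have : p / q * powR g (p - q) < 1 - k.
  by rewrite mulrC -invf_div ltr_pdivrMr ?divr_gt0.
by clear; lra.
Qed.

End Conclusion.

Theorem theorem4p16 (R : realType) (a p q : R) :
  0 < a < 1 -> 0 < p -> 0 < q ->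
  let cond_i := forall (n : nat) (A B : 'M[R[i]]_n),
      psdmx A -> psdmx B -> loewner_le (Gmean a p A B) (Amean a q A B) in
  let cond_ii := forall A B : 'M[R[i]]_2,
      pdmx A -> pdmx B -> loewner_le (Gmean a p A B) (Amean a q A B) in
  let cond_iii := 1 <= p <= q in
  (cond_i <-> cond_ii) /\ (cond_ii <-> cond_iii).
Proof.
move=> a01 p0 q0 cond_i cond_ii cond_iii.
have i_ii : cond_i -> cond_ii.
  by move=> h A B hA hB; apply: h; exact: pd_psd.
have ii_iii : cond_ii -> cond_iii.
  (* The bound [1 <= p] comes first because the second test applies Jensen with exponent [1/p]. *)
  move=> h; have p1 := exponent_ge1 a01 p0 q0 h.
  by apply/andP; split => //; exact: exponent_le a01 p1 q0 h.
have iii_i : cond_iii -> cond_i.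
  move=> h n A B; apply: Gmean_le_Amean => //.
  by case/andP: a01 => /ltW -> /ltW ->.
split; split; [exact: i_ii|by move/ii_iii/iii_i|exact: ii_iii|by move/iii_i/i_ii].
Qed.
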